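(* Let $e$ be a positive integer, $n\in\mathbb{N}$, $\lambda$ a partition of $n$, and $\ell$ any integer greater than or equal to the length of $\lambda$. Let $a_\lambda$ be the coefficient of $s_\lambda$ in the Schur expansion $W_n^{(e)}=\sum_{\lambda\vdash n}a_\lambda s_\lambda$. Then $a_\lambda$ is equal to the number of standard Young tableaux of skew shape $\xi(\lambda)$.
   Context: Let $\Lambda$ be the ring of symmetric functions in $x_1,x_2,\ldots$, with Schur functions $s_\lambda$ and monomial symmetric functions $m_\lambda$. Let $\mu_e\subset\mathbb{C}$ be the set of $e$-th roots of $1$. For $n\in\mathbb{N}$ define the symmetric polynomial $$W_n^{(e)}(x_1,\dotsc,x_r)=\frac{1}{e^r}\sum_{\zeta_1,\dotsc,\zeta_r\in\mu_e}\left(\sum_{i=1}^r \zeta_i\sqrt[e]{x_i}\right)^{en},$$ where $\sqrt[e]{x_i}$ is any fixed $e$-th root of $x_i$ (the result does not depend on the choice and is a polynomial in the $x_i$). Taking the inverse limit over $r$ defines a symmetric function $W_n^{(e)}\in\Lambda$, homogeneous of degree $n$. Equivalently, $$W_n^{(e)}=\sum_{\lambda\vdash n}\binom{en}{e\lambda}m_\lambda,$$ where $e\lambda=(e\lambda_1,e\lambda_2,\ldots)$ and $\binom{en}{e\lambda}=\frac{(en)!}{\prod_i (e\lambda_i)!}$ is a multinomial coefficient. Given a partition $\lambda$ of $n$ and $\ell$ at least the length of $\lambda$ (with $\lambda_i=0$ for $i$ larger than the length), define partitions $$\nu=(e\lambda_1+(\ell-1)(e-1),\,e\lambda_2+(\ell-2)(e-1),\,\ldots,\,e\lambda_\ell),\qquad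 \mu=((\ell-1)(e-1),\,(\ell-2)(e-1),\,\ldots,\,0),$$ i.e. $\nu_i=e\lambda_i+(\ell-i)(e-1)$ and $\mu_i=(\ell-i)(e-1)$ for $1\le i\le \ell$, and define the skew shape $\xi(\lambda)=\nu/\mu$ (which has $en$ boxes). *)

(* Defs.v *)
From HB Require Import structures.
From mathcomp Require Import all_boot all_order all_algebra all_fingroup.
From mathcomp Require Import all_solvable all_field.
From mathcomp Require Import mpoly.

Set Implicit Arguments.
Unset Strict Implicit.
Unset Printing Implicit Defensive.

Import Order.TTheory GRing.Theory Num.Theory.
Local Open Scope ring_scope.

(* A partition of n is stored as the n-tuple of its parts, in weakly decreasing
   order and padded with zeros: it has at most n parts, each at most n. *)
Definition is_intpart (n : nat) (t : n.-tuple 'I_n.+1) : bool :=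
  sorted geq [seq val i | i <- t] && (sumn [seq val i | i <- t] == n).

Definition intpart (n : nat) := {t : n.-tuple 'I_n.+1 | is_intpart t}.

Definition parts (n : nat) (la : intpart n) : seq nat :=
  [seq val i | i <- val la].

Definition part_length (n : nat) (la : intpart n) : nat :=
  count (fun k => k != 0%N) (parts la).

(* Boxes (i, j), numbered from 0 in English notation, of the skew shape nu / mu;
   missing parts are 0, so that [cell la [::]] is the set of boxes of la. *)
Definition cell (nu mu : seq nat) :=
  {p : 'I_(size nu) * 'I_(\max_(k <- nu) k)
  | (nth 0%N mu p.1 <= p.2 < nth 0%N nu p.1)%N}.

Definition crow (nu mu : seq nat) (b : cell nu mu) : nat := (val b).1.
Definition ccol (nu mu : seq nat) (b : cell nu mu) : nat := (val b).2.

(* The entries of a tableau with values in 'I_N are shifted by one: they are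
   0, ..., N - 1 instead of 1, ..., N. *)
Definition is_SSYT (nu mu : seq nat) (N : nat)
    (T : {ffun cell nu mu -> 'I_N}) : bool :=
  [forall b, forall c,
    ((crow b == crow c) && (ccol b < ccol c)%N ==> (T b <= T c)%N)
    && ((ccol b == ccol c) && (crow b < crow c)%N ==> (T b < T c)%N)].

Definition is_SYT (nu mu : seq nat)
    (T : {ffun cell nu mu -> 'I_(#|{: cell nu mu}|)}) : bool :=
  [&& injectiveb T,
    [forall b, forall c,
      (crow b == crow c) && (ccol b < ccol c)%N ==> (T b < T c)%N] &
    [forall b, forall c,
      (ccol b == ccol c) && (crow b < crow c)%N ==> (T b < T c)%N]].

Definition SYT (nu mu : seq nat) := [set T | @is_SYT nu mu T].

(* The indices are shifted by one: entry i is the part numbered i + 1. *)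
Definition xi_outer (e l n : nat) (la : intpart n) : seq nat :=
  mkseq (fun i => e * nth 0 (parts la) i + (l - i.+1) * (e - 1))%N l.

Definition xi_inner (e l : nat) : seq nat :=
  mkseq (fun i => (l - i.+1) * (e - 1))%N l.

Section SymmetricFunctions.

(* The field of complex numbers: algC, or R[i] for a real closed field R. *)
Variable C : numClosedFieldType.

(* As an element of the inverse limit of the rings of symmetric polynomials, a
   symmetric function is given by its images F r in r variables for all r. *)
Definition sfamily := forall r : nat, {mpoly C[r]}.

Definition schur (la : seq nat) : sfamily := fun r =>
  \sum_(T : {ffun cell la [::] -> 'I_r} | is_SSYT T) \prod_b 'X_(T b).

Definition is_schur_expansion (n : nat) (F : sfamily)
    (a : intpart n -> C) : Prop :=
  forall r, F r = \sum_(la : intpart n) a la *: schur (parts la) r.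

Definition unity_roots (e : nat) : seq C :=
  sval (closed_field_poly_normal ('X^e - 1 : {poly C})).

(* W_n^(e) as a polynomial in the e-th roots of the variables. *)
Definition Wroot (e n : nat) : sfamily := fun r =>
  (e%:R ^+ r)^-1 *:
    \sum_(zeta : {ffun 'I_r -> seq_sub (unity_roots e)})
      (\sum_(i < r) val (zeta i) *: 'X_i) ^+ (e * n).

(* Only the powers of the X_i ^+ e occur in Wroot (Wroot_dvd); W is obtained
   by replacing X_i ^+ e with X_i, see W_eval. *)
Definition W (e n : nat) : sfamily := fun r =>
  \sum_(m <- msupp (Wroot e n r))
    (Wroot e n r)@_m *: 'X_[[multinom (m i %/ e)%N | i < r]].

Section Facts.

Variables (e : nat) (e_gt0 : (0 < e)%N).

Let XnP : 'X^e - 1 = \prod_(z <- unity_roots e) ('X - z%:P) :> {poly C}.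
Proof.
rewrite /unity_roots; case: closed_field_poly_normal => s /= ->.
by rewrite lead_coefXnsubC // scale1r.
Qed.

Lemma mem_unity_roots z : (z \in unity_roots e) = (z ^+ e == 1).
Proof.
by rewrite -root_prod_XsubC -XnP rootE !hornerE subr_eq0.
Qed.

Lemma exists_prim_root : exists z : C, e.-primitive_root z.
Proof.
have uniq_s : uniq (unity_roots e).
  rewrite -separable_prod_XsubC -XnP separable_Xn_sub_1 //.
  by rewrite pnatr_eq0 -lt0n.
have size_s : size (unity_roots e) = e.
  have := size_prod_XsubC (unity_roots e) id.
  by rewrite -XnP size_XnsubC // => -[].
have /hasP[z _ zP] : has e.-primitive_root (unity_roots e).
  apply: has_prim_root; rewrite ?size_s //.
  by apply/allP => z; rewrite mem_unity_roots unity_rootE.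
by exists z.
Qed.

Lemma Wroot_dvd n r m (i : 'I_r) : m \in msupp (Wroot e n r) -> (e %| m i)%N.
Proof.
have [w wP] := exists_prim_root.
have w0 : w != 0.
  apply/eqP => w0; move/eqP: (prim_expr_order wP).
  by rewrite w0 expr0n gtn_eqF // eq_sym oner_eq0.
have hP (z : seq_sub (unity_roots e)) : w * val z \in unity_roots e.
  rewrite mem_unity_roots exprMn (prim_expr_order wP) mul1r.
  by rewrite -mem_unity_roots (valP z).
pose h z : seq_sub (unity_roots e) := SeqSub (hP z).
have hI : injective h.
  by move=> x y /(congr1 val) /= /(mulfI w0) /val_inj.
pose c (j : 'I_r) : C := if j == i then w else 1.
pose lq := [tuple c j *: 'X_j : {mpoly C[r]} | j < r].
pose H (zeta : {ffun 'I_r -> seq_sub (unity_roots e)}) :=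
  [ffun j => if j == i then h (zeta j) else zeta j].
have HI : injective H.
  move=> x y /ffunP E; apply/ffunP => j; have := E j; rewrite !ffunE.
  by case: ifP => // _ /hI.
have inv : Wroot e n r \mPo lq = Wroot e n r.
  rewrite /Wroot comp_mpolyZ; congr (_ *: _).
  rewrite [in RHS](reindex_inj HI) /= raddf_sum /=.
  apply: eq_bigr => zeta _.
  rewrite rmorphXn /= raddf_sum /=; congr (_ ^+ _); apply: eq_bigr => j _.
  rewrite comp_mpolyZ comp_mpolyXU -tnth_nth tnth_mktuple scalerA ffunE /c.
  by case: ifP => _ /=; rewrite ?mulr1 // mulrC.
have coef p : (p \mPo lq)@_m = w ^+ m i * p@_m.
  rewrite comp_mpolyEX raddf_sum /= [in RHS](mpolyE p) [in RHS]raddf_sum.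
  rewrite mulr_sumr; apply: eq_bigr => m' _ /=.
  rewrite !mcoeffZ comp_mpolyX.
  under eq_bigr => j _ do rewrite tnth_mktuple exprZn.
  rewrite scaler_prod -mpolyXE_id mcoeffZ mcoeffX.
  case: eqP => [<-|_]; rewrite ?mulr0 // !mulr1 mulrC; congr (_ * _).
  rewrite (bigD1 i) //= big1 ?mulr1 /c ?eqxx // => j /negPf->.
  by rewrite expr1n.
rewrite mcoeff_msupp => m0; have := coef (Wroot e n r); rewrite inv.
rewrite -[LHS]mul1r => /(mulIf m0) E.
by rewrite (prim_order_dvd wP) -E.
Qed.

Lemma W_eval n r (x y : 'I_r -> C) : (forall i, y i ^+ e = x i) ->
  (W e n r).@[x] = (e%:R ^+ r)^-1 *
    \sum_(zeta : {ffun 'I_r -> seq_sub (unity_roots e)})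
      (\sum_(i < r) val (zeta i) * y i) ^+ (e * n).
Proof.
move=> yx; transitivity (Wroot e n r).@[y]; last first.
  rewrite mevalZ raddf_sum /=; congr (_ * _); apply: eq_bigr => zeta _.
  rewrite rmorphXn; congr (_ ^+ _); rewrite raddf_sum /=.
  by apply: eq_bigr => i _; rewrite mevalZ mevalXU.
rewrite [RHS]mevalE /W raddf_sum /= big_seq [RHS]big_seq; apply: eq_bigr => m mP.
rewrite mevalZ mevalX; congr (_ * _); apply: eq_bigr => i _.
by rewrite mnmE -yx -exprM mulnC divnK // (Wroot_dvd i mP).
Qed.

End Facts.

End SymmetricFunctions.

(* Main.v *)
(** Write d = (l-1, ..., 1, 0) and a_d for the Vandermonde alternant in l
    variables.  The coefficient of x^(la+d) in a_d s_ka is 1 if ka = la and 0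
    otherwise, so the coefficient of s_la in W is the coefficient of x^(la+d) in
    a_d W, namely (en)! det(1 / (e (la_i + d_i - d_j))!).  By the Jacobi-Trudi
    formula for skew shapes, whose coefficient at x_1 ... x_N is Aitken's
    determinant, this is the number of standard tableaux of shape xi(la),
    because nu_i + d_i = e (la_i + d_i) and mu_j + d_j = e d_j.

    The orthogonality is proved without a_d s_ka = a_(ka+d): the matrix of these
    coefficients is unitriangular for the dominance order (tableaux) and
    symmetric, since by Jacobi-Trudi both indices occur symmetrically in a count
    of nonnegative integer matrices with prescribed margins. *)

Require Import Defs.
From mathcomp Require Import all_boot all_order all_algebra all_fingroup.
From mathcomp Require Import mpoly.
From mathcomp Require Import zify.

Set Implicit Arguments.
Unset Strict Implicit.
Unset Printing Implicit Defensive.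

Import Order.TTheory GRing.Theory Num.Theory.
Local Open Scope ring_scope.

(** The Jacobi-Trudi formula is itself proved here, by induction on the number of variables:
    removing the boxes with the largest entry leaves a shape interlacing with the outer one, and row
    operations give the determinant the same recursion. Diagrams are therefore abstract finite types
    with coordinates, a notion closed under that removal. The exchange of indices behind the
    symmetry works in as many variables as there are rows: the alternant and the Jacobi-Trudi
    determinant are then both signed sums over permutations of one and the same staircase.
    Orthogonality determines the coefficients but does not show that an expansion exists. For this,
    the difference of W and the candidate expansion is excluded by its leading monomial, in each
    number r of variables separately. Since r, the number l of rows and the padding length n are
    unrelated, the argument also uses that a Schur polynomial with more rows than variables vanishes
    and that the factorial determinant is unchanged by extra zero parts. *)

Definition staircase (l i : nat) : nat := (l - i.+1)%N.

(** * Complete homogeneous polynomials and row reduction of the Jacobi-Trudi matrix *)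

Section CompleteSymmetric.

Variables (R : comNzRingType) (y : nat -> R).

(* The complete homogeneous polynomial h_(b - a) in y_0, ..., y_(N - 1), where
   h_k = 0 for k < 0; two arguments avoid the truncated difference. *)
Fixpoint hdiff (N b a : nat) : R :=
  if N is N'.+1 then \sum_(0 <= c < b.+1) y N' ^+ (b - c) * hdiff N' c a
  else (b == a)%:R.

Arguments hdiff : simpl never.

Definition jtmx (l N : nat) (nu mu : nat -> nat) : 'M[R]_l :=
  \matrix_(i, j) hdiff N (nu i + staircase l i) (mu j + staircase l j).

(** The terms with c at most b' are those of the sum for b', each multiplied by the same power of
    the last variable. Subtracting this multiple leaves the range b' < c <= b, which becomes the
    interlacing condition. *)
Lemma hdiff_split N a b b' : (b' < b)%N ->
  hdiff N.+1 b a = y N ^+ (b - b') * hdiff N.+1 b' a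
    + \sum_(b'.+1 <= c < b.+1) y N ^+ (b - c) * hdiff N c a.
Proof.
move=> ltb; rewrite {1}/hdiff -/hdiff (@big_cat_nat _ _ _ b'.+1) //=;
  last by lia.
congr (_ + _); rewrite big_distrr /=; apply: eq_big_nat => c /andP[_ ltc].
by rewrite mulrA -exprD; congr (_ ^+ _ * _); lia.
Qed.

(** The rows of the determinant have different summation ranges; one common index type allows the
    product of these sums to be expanded over functions. *)
Lemma big_interval_ord (V : nmodType) M a b (F : nat -> V) : (b <= M)%N ->
  \sum_(a <= c < b.+1) F c = \sum_(c < M.+1 | (a <= c <= b)%N) F c.
Proof.
move=> leM; rewrite (@big_ord_narrow_cond _ _ _ b.+1 M.+1) //.
rewrite -big_mkord; case: (leqP a b.+1) => [leab|ltab].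
  rewrite big_mkcond; rewrite [RHS]big_mkcond.
  rewrite [RHS](@big_cat_nat _ _ _ a) //=.
  rewrite [X in _ = X + _]big_nat_cond [X in _ = X + _]big1 ?add0r; last first.
    by move=> i /andP[/andP[_ lti] _]; case: ifP => //; lia.
  by apply: eq_big_nat => i /andP[lei lti]; rewrite ifT //; lia.
rewrite [LHS]big_geq; last by lia.
by rewrite big_nat_cond big1 // => i; lia.
Qed.

(* Row i minus y_N ^ (..) times row i + 1, for all i at once, turns the entries
   into sums over interlacing parts. *)
Lemma det_jtmx_step l M N nu mu :
    (forall i, nu i.+1 <= nu i)%N -> nu l = 0%N -> (nu 0 <= M)%N ->
  \det (jtmx l N.+1 nu mu) =
    \sum_(ka : {ffun 'I_l -> 'I_M.+1} | [forall i : 'I_l,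
      nu i.+1 <= ka i <= nu i]%N)
      (\prod_(i < l) y N ^+ (nu i - ka i)) *
        \det (\matrix_(i < l, j < l)
          hdiff N (ka i + staircase l i) (mu j + staircase l j)).
Proof.
move=> nuS nul nu0.
have nuM i : (nu i <= M)%N by elim: i => // i /(leq_trans (nuS i)).
pose b i := (nu i + staircase l i)%N.
have ltb i : (i.+1 < l)%N -> (b i.+1 < b i)%N.
  by rewrite /b /staircase; have := nuS i; lia.
pose A : 'M[R]_l := \matrix_(i, j) \sum_(nu i.+1 <= c < (nu i).+1)
  y N ^+ (nu i - c) * hdiff N (c + staircase l i) (mu j + staircase l j).
pose U : 'M[R]_l := \matrix_(i, j)
  ((i == j)%:R - (j == i.+1 :> nat)%:R * y N ^+ (b i - b j)).
have detU : \det U = 1.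
  rewrite -det_tr det_trig; last first.
    apply/is_trig_mxP => i j ltij; rewrite !mxE.
    rewrite -!val_eqE /=; have -> : (j == i :> nat) = false by lia.
    have -> : (i == j.+1 :> nat) = false by lia.
    by rewrite mul0r subr0.
  rewrite big1 // => i _; rewrite !mxE eqxx (_ : (_ == _.+1) = false);
    last by lia.
  by rewrite mul0r subr0.
have UA : U *m jtmx l N.+1 nu mu = A.
  apply/matrixP => i j; rewrite !mxE.
  under eq_bigr => k _ do rewrite !mxE mulrBl.
  rewrite sumrB [X in X - _](bigD1 i) //= eqxx mul1r.
  rewrite [X in _ + X - _]big1 ?addr0; last first.
    by move=> k /negPf nki; rewrite eq_sym nki mul0r.
  set a := (mu j + _)%N; rewrite -!/(b _).
  have shift B :
    \sum_(B + staircase l i <= c < (b i).+1) y N ^+ (b i - c) * hdiff N c a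
    = \sum_(B <= c < (nu i).+1) y N ^+ (nu i - c) * hdiff N (c + staircase l i)
      a.
    rewrite -{1}[(b i).+1](_ : (nu i).+1 + staircase l i = _)%N; last first.
      by rewrite /b addSn.
    rewrite big_addn addnK; apply: eq_big_nat => c _.
    by congr (_ ^+ _ * _); rewrite /b; lia.
  have [lti|gei] := ltnP i.+1 l.
    rewrite (bigD1 (Ordinal lti)) //= eqxx mul1r [X in _ - (_ + X)]big1 ?addr0;
      last first.
      by move=> k; rewrite -val_eqE /= => /negPf ->; rewrite !mul0r.
    rewrite (hdiff_split _ _ (ltb _ lti)).
    rewrite addrAC subrr add0r -shift //.
    (* Consecutive staircase entries differ by 1, so the strict lower bound c > b (i+1) becomes the
       weak bound nu (i+1) <= ka i. *)
    by rewrite (_ : (b i.+1).+1 = nu i.+1 + staircase l i)%N //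
       /b /staircase; lia.
  (* The last row has no row below it and stays unchanged; its staircase entry and [nu l] are both
     0, so its full sum already has the required range. *)
  rewrite [X in _ - X]big1 ?subr0; last first.
    move=> k _; rewrite (_ : (_ == _) = false) ?mul0r //.
    by have := ltn_ord k; lia.
  have il : i.+1 = l by have := ltn_ord i; lia.
  rewrite il nul -shift // add0n (_ : staircase l i = 0%N) //.
  by rewrite /staircase; lia.
have -> : \det (jtmx l N.+1 nu mu) = \det A by rewrite -UA det_mulmx detU mul1r.
rewrite /determinant.
under eq_bigr => s _.
  under eq_bigr => i _ do rewrite mxE (big_interval_ord _ _ (nuM i)) big_mkcond.
  rewrite bigA_distr_bigA mulr_sumr /=.
  over.
rewrite exchange_big [RHS]big_mkcond; apply: eq_bigr => ka _ /=.
case: ifPn => [/forallP kaP|].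
  rewrite mulr_sumr; apply: eq_bigr => s _.
  rewrite mulrCA -big_split /=; congr (_ * _).
  by apply: eq_bigr => i _; rewrite kaP !mxE.
rewrite negb_forall => /existsP[i nkai]; rewrite big1 // => s _.
by rewrite (bigD1 i) //= (negPf nkai) mul0r mulr0.
Qed.

End CompleteSymmetric.

(** The image of the sorted enumeration is again sorted and has the same elements, so it is the same
    list. *)
Lemma perm_homo_ltn l (s : 'S_l) : {homo s : i j / (i < j)%N} -> s = 1%g.
Proof.
move=> sI; pose lt := relpre (val : 'I_l -> nat) ltn.
have ltT : transitive lt by move=> i j k; apply: ltn_trans.
have lt_enum : sorted lt (enum 'I_l) by rewrite -sorted_map val_enum_ord
  iota_ltn_sorted.
have E : map s (enum 'I_l) = enum 'I_l.
  apply: (irr_sorted_eq ltT) => //; first by move=> i; exact: ltnn.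
    exact: homo_sorted lt_enum.
  move=> i; rewrite mem_enum; apply/mapP; exists (s^-1%g i);
    first by rewrite mem_enum.
  by rewrite permKV.
apply/permP => i; rewrite perm1.
have /(congr1 (fun r => nth i r i)) := E.
by rewrite (nth_map i) ?size_enum_ord // nth_ord_enum.
Qed.

Lemma antitone_leq (nu : nat -> nat) : (forall i, nu i.+1 <= nu i)%N ->
  forall i j, (i <= j)%N -> (nu j <= nu i)%N.
Proof.
move=> nuS i j /subnK <-; elim: (j - i)%N => // k; apply: leq_trans.
by rewrite addSn.
Qed.

Lemma staircase_ltn (nu : nat -> nat) l : (forall i, nu i.+1 <= nu i)%N ->
  forall i j, (i < j < l)%N -> (nu j + staircase l j < nu i + staircase l i)%N.
Proof.
move=> nuS i j ltij; have := @antitone_leq _ nuS i j; rewrite /staircase; lia.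
Qed.

(** * Abstract diagrams and their semistandard fillings *)

Section BigShape.

Variables (D : finType) (row col : D -> nat).

(** The boxes form an arbitrary finite type, identified by their coordinates with the first l rows
    of nu/mu. A subtype of boxes can then again be a shape, as the induction on entries requires. *)
Definition is_shape (l : nat) (nu mu : nat -> nat) : Prop :=
  injective (fun b => (row b, col b)) /\
  forall i j, (exists b, row b = i /\ col b = j) <->
    (i < l)%N /\ (mu i <= j < nu i)%N.

Lemma big_shape (S : Type) (idx : S) (op : Monoid.com_law idx) l nu mu
    (G : nat -> nat -> S) : is_shape l nu mu ->
  \big[op/idx]_b G (row b) (col b) =
    \big[op/idx]_(i < l) \big[op/idx]_(mu i <= j < nu i) G i j.
Proof.
move=> [inj mem]; pose H p := G p.1 p.2.
pose s := [seq (i, j) | i <- index_iota 0 l, j <- index_iota (mu i) (nu i)].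
transitivity (\big[op/idx]_(p <- s) H p).
  rewrite -[LHS](big_map (fun b => (row b, col b)) xpredT H).
  apply/perm_big/uniq_perm.
  - by rewrite map_inj_uniq ?index_enum_uniq.
  - apply: allpairs_uniq_dep => [|i _|]; rewrite ?iota_uniq //.
    by move=> [i j] [i' j'] _ _ /= [-> ->].
  move=> [i j]; apply/mapP/allpairsPdep.
    move=> [b _ [-> ->]]; exists (row b), (col b).
    have /mem[ltl ltc] : exists c, row c = row b /\ col c = col b by exists b.
    by rewrite !mem_index_iota.
  move=> [i' [j' [+ + [-> ->]]]]; rewrite !mem_index_iota /= => lti ltj.
  have [b [<- <-]] := proj2 (mem i' j') (conj lti ltj).
  by exists b; rewrite // mem_index_enum.
by rewrite /s big_allpairs_dep big_mkord.
Qed.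

Definition ssyt (T : D -> nat) : bool :=
  [forall b, forall c,
    ((row b == row c) && (col b < col c)%N ==> (T b <= T c)%N)
    && ((col b == col c) && (row b < row c)%N ==> (T b < T c)%N)].

Lemma ssytP T : reflect
  ((forall b c, row b = row c -> (col b < col c)%N -> (T b <= T c)%N) /\
   (forall b c, col b = col c -> (row b < row c)%N -> (T b < T c)%N)) (ssyt T).
Proof.
apply: (iffP forallP) => [TP|[Tr Tc] b].
  by split=> b c /eqP E lt; have /forallP/(_ c)/andP[] := TP b; rewrite E lt.
by apply/forallP => c; apply/andP; split; apply/implyP => /andP[/eqP];
  [exact: Tr | exact: Tc].
Qed.

End BigShape.

(** * Base case and vanishing of the Jacobi-Trudi determinant *)

Section JacobiTrudi.

Variables (R : comNzRingType) (y : nat -> R) (l : nat).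

(** Without variables the entries only test equality of nu_i + d_i and mu_j + d_j. Both sequences
    decrease strictly, so a permutation matching them is increasing, hence the identity. *)
Lemma det_jtmx0 nu mu :
    (forall i, nu i.+1 <= nu i)%N -> (forall i, mu i.+1 <= mu i)%N ->
  \det (jtmx y l 0 nu mu) = [forall i : 'I_l, nu i == mu i]%:R.
Proof.
move=> nuS muS; have [/forallP E|] := boolP [forall i : 'I_l, nu i == mu i].
  rewrite (_ : jtmx _ _ _ _ _ = 1%:M) ?det1 //; apply/matrixP => i j.
  rewrite !mxE /hdiff (eqP (E i)); congr (nat_of_bool _)%:R.
  apply/eqP/eqP => [ij|-> //]; apply: val_inj => /=.
  have := @staircase_ltn _ l muS i j; have := @staircase_ltn _ l muS j i.
  have := ltn_ord i; have := ltn_ord j; lia.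
rewrite negb_forall => /existsP[i0 ne]; rewrite /determinant big1 // => s _.
have [/forallP E|] :=
    boolP [forall i : 'I_l, nu i + staircase l i == mu (s i) + staircase l (s
      i)]%N.
  suff s1 : s = 1%g.
    by case/negP: ne; have /eqP := E i0; rewrite s1 perm1 => /addIn ->.
  apply: perm_homo_ltn => i j ltij; rewrite ltnNge; apply/negP => le.
  have := @staircase_ltn _ l nuS i j; have := @staircase_ltn _ l muS (s j) (s
    i).
  rewrite -!(eqP (E _)) ltij (ltn_ord j) (ltn_ord (s i)) !andbT => h1 h2.
  have: (s j < s i)%N.
    by rewrite ltn_neqAle le andbT val_eqE (inj_eq perm_inj) eq_sym -val_eqE
      ltn_eqF.
  by move/h1; have := h2 isT; lia.
rewrite negb_forall => /existsP[i ni].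
by rewrite (bigD1 i) //= !mxE /hdiff (negPf ni) mul0r mulr0.
Qed.

(** Extension by 0 makes an interlacing ka an outer shape in its own right, with the condition
    [nu l = 0] that the next step of the induction assumes. *)
Definition ext_ord M (ka : {ffun 'I_l -> 'I_M}) (i : nat) : nat :=
  oapp (fun j => ka j : nat) 0%N (insub i).

Lemma ext_ord_val M (ka : {ffun 'I_l -> 'I_M}) (i : 'I_l) : ext_ord ka i = ka i.
Proof. by rewrite /ext_ord valK. Qed.

Lemma ext_ord_out M (ka : {ffun 'I_l -> 'I_M}) i : (l <= i)%N ->
  ext_ord ka i = 0%N.
Proof. by move=> lei; rewrite /ext_ord insubF // ltnNge lei. Qed.

Lemma ext_ord_antitone M nu (ka : {ffun 'I_l -> 'I_M}) :
    [forall i : 'I_l, nu i.+1 <= ka i <= nu i]%N ->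
  forall i, (ext_ord ka i.+1 <= ext_ord ka i)%N.
Proof.
move=> /forallP kaP i; have [le|lt] := leqP l i.+1;
  first by rewrite ext_ord_out.
have lt' := ltnW lt; rewrite -[i.+1]/(val (Ordinal lt)) -[i]/(val (Ordinal
  lt')).
rewrite !ext_ord_val; have := kaP (Ordinal lt); have := kaP (Ordinal lt') =>
  /=; lia.
Qed.

Lemma jtmx_ext_ord M N (mu : nat -> nat) (ka : {ffun 'I_l -> 'I_M}) :
  \matrix_(i < l, j < l) hdiff y N (ka i + staircase l i) (mu j + staircase l j)
    = jtmx y l N (ext_ord ka) mu.
Proof. by apply/matrixP => i j; rewrite !mxE ext_ord_val. Qed.

(** The defect nu_i < mu_i is inherited by every ka in the row reduction, since ka_i <= nu_i, and it
    makes the base case 0. This disposes of the ka that do not contain mu, to which no tableaux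
    correspond. *)
Lemma det_jtmx_eq0 N nu mu (i : 'I_l) :
    (forall i, nu i.+1 <= nu i)%N -> (forall i, mu i.+1 <= mu i)%N ->
    nu l = 0%N -> (nu i < mu i)%N ->
  \det (jtmx y l N nu mu) = 0.
Proof.
move=> + muS; elim: N nu => [|N IHN] nu nuS nul lti.
  rewrite det_jtmx0 // (_ : [forall _, _] = false) //.
  by apply/forallP => /(_ i); rewrite ltn_eqF.
rewrite (@det_jtmx_step _ _ _ (nu 0%N)) // big1 // => ka kaP.
rewrite jtmx_ext_ord IHN ?mulr0 //.
- exact: ext_ord_antitone kaP.
- by rewrite ext_ord_out.
by rewrite ext_ord_val (leq_ltn_trans _ lti) //; have /forallP/(_ i)/andP[] :=
  kaP.
Qed.

End JacobiTrudi.

(** * The branching rule for tableaux and the Jacobi-Trudi formula *)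

Section Branching.

Variables (R : comNzRingType) (y : nat -> R) (l V : nat) (mu : nat -> nat).
Hypothesis muS : forall i, (mu i.+1 <= mu i)%N.

(* The entries live in a fixed type 'I_V so that the bound N can vary in the
   induction. *)
Definition ssyt_sum (D : finType) (row col : D -> nat) (N : nat) : R :=
  \sum_(T : {ffun D -> 'I_V} | ssyt row col (fun b => T b) && [forall b,
    (T b < N)%N])
    \prod_b y (T b).

(** The bound mu <= ka makes the cut unique: to the left of mu_i a row has no boxes that could
    distinguish two values of ka_i. *)
Definition interlacing M (nu : nat -> nat) (ka : {ffun 'I_l ->
  'I_M.+1}) : bool :=
  [forall i : 'I_l, nu i.+1 <= ka i <= nu i]%N
  && [forall i : 'I_l, mu i <= ka i]%N.

Definition cut_at M (D : finType) (row col : D -> nat) N (T : D -> nat)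
    (ka : {ffun 'I_l -> 'I_M.+1}) : bool :=
  [forall b, (T b < N)%N == (col b < ext_ord ka (row b))%N].

Section Step.

Variables (D : finType) (row col : D -> nat) (nu : nat -> nat) (M N : nat).
Hypothesis nuS : forall i, (nu i.+1 <= nu i)%N.
Hypothesis nul : nu l = 0%N.
Hypothesis nuM : (nu 0 <= M)%N.
Hypothesis munu : forall i, (i < l)%N -> (mu i <= nu i)%N.
Hypothesis shapeD : is_shape row col l nu mu.

Lemma shape_row b : (row b < l)%N.
Proof. by have [_ /(_ (row b) (col b))[]] := shapeD; case; [exists b|]. Qed.

Lemma shape_col b : (mu (row b) <= col b < nu (row b))%N.
Proof. by have [_ /(_ (row b) (col b))[]] := shapeD; case; [exists b|]. Qed.

Lemma shape_ex i j : (i < l)%N -> (mu i <= j < nu i)%N ->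
  exists b, row b = i /\ col b = j.
Proof. by move=> lti ltj; have [_ /(_ i j)[_]] := shapeD; apply. Qed.

Lemma shape_inj b c : row b = row c -> col b = col c -> b = c.
Proof. by move=> E1 E2; have [inj _] := shapeD; apply: inj; rewrite E1 E2. Qed.

(** Rows increase weakly, so the entries below N form an initial segment of each row, and its end is
    the cut. Two different cuts would disagree on the box at the smaller of them. *)
Lemma cut_at_unique (T : D -> nat) :
    ssyt row col T -> (forall b, (T b < N.+1)%N) ->
  exists ka0, (fun ka : {ffun 'I_l -> 'I_M.+1} =>
    interlacing nu ka && cut_at row col N T ka) =1 pred1 ka0.
Proof.
move=> /ssytP[Tr Tc] TN.
have ex_ka (i : 'I_l) : exists k : 'I_M.+1, (mu i <= k <= nu i)%N /\
    forall b, row b = i -> (T b < N)%N = (col b < k)%N.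
  (* The cut is the least column holding an entry at least N, or [nu i] if row i has no such
     entry. *)
  pose P k := (mu i <= k)%N && ((nu i <= k)%N ||
    [exists b, [&& row b == i, col b == k & (N <= T b)%N]]).
  have exP : exists k, P k by exists (nu i); rewrite /P leqnn munu.
  case: (ex_minnP exP) => k /andP[lek Pk] minP.
  have lekn : (k <= nu i)%N by apply: minP; rewrite /P leqnn munu.
  have nuiM : (nu i <= M)%N by apply: leq_trans nuM; exact: antitone_leq.
  exists (inord k); rewrite inordK ?ltnS ?(leq_trans lekn) //; split=> [|b rb].
    by rewrite lek.
  have := shape_col b; rewrite rb => /andP[lb ub].
  apply/idP/idP => [ltT|ltk]; last first.
    rewrite ltnNge; apply/negP => leT.
    have /minP : P (col b); last by lia.
    rewrite /P lb; apply/orP; right; apply/existsP; exists b.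
    by rewrite rb !eqxx.
  rewrite ltnNge; apply/negP => lekb.
  case/orP: Pk => [|/existsP[c /and3P[/eqP rc /eqP cc leT]]]; first by lia.
  have [ltc|eqc] : (col c < col b)%N \/ col c = col b by lia.
    by have := Tr c b _ ltc; rewrite rb rc => /(_ erefl); lia.
  by have := @shape_inj c b _ eqc; rewrite rb rc => /(_ erefl) E; move: leT;
    rewrite E; lia.
have [ka0 ka0P] := @fin_all_exists _ _ _ ex_ka.
exists [ffun i => ka0 i] => ka /=; apply/idP/eqP => [|->].
  move=> /andP[/andP[/forallP h1 /forallP h2] /forallP h3].
  apply/ffunP => i; rewrite ffunE; apply: val_inj => /=.
  have [lei E] := ka0P i; have := h1 i; have := h2 i => h4 h5.
  have cE b : row b = i -> (col b < ka i)%N = (col b < ka0 i)%N.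
    by move=> rb; rewrite -E // (eqP (h3 b)) rb ext_ord_val.
  apply/eqP; rewrite eqn_leq; apply/andP; split; rewrite leqNgt; apply/negP =>
    lt.
    have [b [rb cb]] : exists b, row b = i /\ col b = ka0 i.
      by apply: shape_ex => //; lia.
    by have := cE b rb; rewrite cb lt ltnn.
  have [b [rb cb]] : exists b, row b = i /\ col b = ka i.
    by apply: shape_ex => //; lia.
  by have := cE b rb; rewrite cb lt ltnn.
have ka0E b : (T b < N)%N = (col b < ka0 (Ordinal (shape_row b)))%N.
  by have [_ ->] := ka0P (Ordinal (shape_row b)).
apply/andP; split; last first.
  apply/forallP => b; rewrite ka0E -[row b]/(val (Ordinal (shape_row b))).
  by rewrite ext_ord_val ffunE.
apply/andP; split; apply/forallP => i; rewrite ffunE; have [le E] := ka0P i;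
  last by lia.
rewrite andbC; apply/andP; split; first by lia.
rewrite leqNgt; apply/negP => lt.
have [lti|gei] := ltnP i.+1 l; last first.
  by move: lt; rewrite (_ : i.+1 = l) ?nul //; have := ltn_ord i; lia.
(* If the cut were left of nu (i+1), the box at the cut, with entry at least N, would have a box
   below it with an entry above N, against the bound on T. *)
have [b [rb cb]] : exists b, row b = i /\ col b = ka0 i.
  by apply: shape_ex => //; have := nuS i; lia.
have [c [rc cc]] : exists c, row c = i.+1 /\ col c = ka0 i.
  by apply: shape_ex => //; have := muS i; lia.
have := Tc b c; rewrite rb cb rc cc => /(_ erefl (leqnn _)).
by have := E b rb; rewrite cb ltnn; have := TN c; lia.
Qed.

Variable ka : {ffun 'I_l -> 'I_M.+1}.
Hypothesis kaP : interlacing nu ka.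

Definition subshape : pred D := fun b => (col b < ext_ord ka (row b))%N.
Let D' := {b : D | subshape b}.
Let ka_nu (i : 'I_l) : (nu i.+1 <= ka i <= nu i)%N.
Proof. by have /andP[/forallP/(_ i)] := kaP. Qed.

Let mu_ka (i : 'I_l) : (mu i <= ka i)%N.
Proof. by have /andP[_ /forallP/(_ i)] := kaP. Qed.

Lemma subshapeE b (i := Ordinal (shape_row b)) : subshape b = (col b < ka i)%N.
Proof. by rewrite /subshape -[row b]/(val i) ext_ord_val. Qed.

Lemma is_shape_sub :
  is_shape (fun b : D' => row (val b)) (fun b : D' =>
    col (val b)) l (ext_ord ka) mu.
Proof.
split=> [b c [E1 E2]|i j]; first by apply/val_inj/shape_inj.
split=> [[b [<- <-]]|[lti]].
  split; first exact: shape_row.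
  by have /andP[-> _] := shape_col (val b); exact: (valP b).
rewrite -[i]/(val (Ordinal lti)) ext_ord_val /= => ltj.
have := ka_nu (Ordinal lti) => /= h.
have [b [rb cb]] : exists b, row b = i /\ col b = j by apply: shape_ex => //=;
  lia.
have bP : subshape b.
  by rewrite /subshape rb cb -[i]/(val (Ordinal lti)) ext_ord_val;
    case/andP: ltj.
by exists (Sub b bP); rewrite SubK.
Qed.

Lemma prod_not_subshape (u : R) :
  \prod_(b | ~~ subshape b) u = \prod_(i < l) u ^+ (nu i - ka i).
Proof.
rewrite big_mkcond /=.
rewrite (big_shape _ (fun i j => if ~~ (j < ext_ord ka i)%N then u else 1)
  shapeD) /=.
apply: eq_bigr => i _; rewrite ext_ord_val.
have := ka_nu i; have := mu_ka i => h1 h2.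
rewrite (@big_cat_nat _ _ _ (ka i)) //=; last by lia.
rewrite big_nat_cond big1 ?mul1r => [|j]; last by case: ifP => //; lia.
rewrite -prodr_const_nat; apply: eq_big_nat => j ltj; rewrite ifT //; lia.
Qed.

Hypothesis ltNV : (N < V)%N.

(** Restriction to the boxes left of the cut is a bijection, with inverse [extT], which puts N in
    all other boxes. These contribute nu_i - ka_i factors in row i. *)
Lemma ssyt_sum_cut_at :
  \sum_(T : {ffun D -> 'I_V} | [&& ssyt row col (fun b => T b),
      [forall b, (T b < N.+1)%N] & cut_at row col N (fun b =>
        T b) ka]) \prod_b y (T b) =
  (\prod_(i < l) y N ^+ (nu i - ka i)) *
    ssyt_sum (fun b : D' => row (val b)) (fun b : D' => col (val b)) N.
Proof.
pose extT (T : {ffun D' -> 'I_V}) : {ffun D -> 'I_V} :=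
  [ffun b => oapp T (Ordinal ltNV) (insub b)].
pose resT (T : {ffun D -> 'I_V}) : {ffun D' -> 'I_V} := [ffun b => T (val b)].
have extTin T b (bP : subshape b) : extT T b = T (Sub b bP).
  by rewrite ffunE insubT.
have extTout T b : ~~ subshape b -> extT T b = N :> nat.
  by move=> bP; rewrite ffunE insubF //; apply/negbTE.
have extT_val T (b : D') : extT T (val b) = T b by rewrite ffunE valK.
have extK T : resT (extT T) = T by apply/ffunP => b; rewrite ffunE extT_val.
rewrite (reindex_onto extT resT) /=; last first.
  move=> T /and3P[_ /forallP TN /forallP TP]; apply/ffunP => b.
  have [bP|nbP] := boolP (subshape b); first by rewrite extTin ffunE.
  apply: val_inj => /=; rewrite extTout //.
  have := eqP (TP b); rewrite -/(subshape b) (negPf nbP); have := TN b; lia.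
rewrite mulr_sumr; apply: eq_big => [T|T _].
  rewrite extK eqxx andbT.
  apply/and3P/andP => [[/ssytP[Tr Tc] TN /forallP TP]|[/ssytP[Tr Tc] /forallP
    TN]].
    split; last first.
      by apply/forallP => b; rewrite -extT_val (eqP (TP _)); exact: (valP b).
    apply/ssytP; split=> b c; rewrite -!extT_val; [exact: Tr | exact: Tc].
  have TN' b : (extT T b < N.+1)%N.
    have [bP|nbP] := boolP (subshape b); last by rewrite extTout.
    by rewrite extTin ltnS ltnW.
  split; last 2 first.
  - exact/forallP.
  - apply/forallP => b; rewrite -/(subshape b); apply/eqP.
    have [bP|nbP] := boolP (subshape b); last by rewrite extTout ?ltnn.
    by rewrite extTin TN.
  apply/ssytP; split=> b c E lt.
    have [cP|ncP] := boolP (subshape c); last first.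
      by rewrite (extTout _ c) // -ltnS.
    have bP : subshape b by move: cP; rewrite /subshape -E => /(ltn_trans lt).
    by rewrite !extTin Tr.
  (* The removed boxes form a horizontal strip: a box with another one below it has its column below
     nu (i+1) <= ka i, hence lies left of the cut. *)
  have bP : subshape b.
    rewrite subshapeE E.
    have := ka_nu (Ordinal (shape_row b)) => /= h.
    have := shape_col c; have := @antitone_leq _ nuS _ _ lt; lia.
  rewrite extTin; have [cP|ncP] := boolP (subshape c).
    by rewrite extTin Tc.
  by rewrite (extTout _ c).
rewrite mulrC -prod_not_subshape (bigID subshape) /= big_sub; congr (_ * _).
  by apply: eq_bigr => b _; rewrite extT_val.
by apply: eq_bigr => b /extTout ->.
Qed.

End Step.

(** Grouping the tableaux by their cut at N yields the recursion of [det_jtmx_step]. The diagram is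
    generalised in the induction because each step replaces it by a subtype. *)
Lemma jacobi_trudi (D : finType) (row col : D -> nat) (nu : nat -> nat) N :
    (forall i, nu i.+1 <= nu i)%N -> nu l = 0%N ->
    (forall i, (i < l)%N -> (mu i <= nu i)%N) ->
    is_shape row col l nu mu -> (N <= V)%N ->
  ssyt_sum row col N = \det (jtmx y l N nu mu).
Proof.
elim: N D row col nu => [|N IHN] D row col nu nuS nul munu shapeD leN.
  rewrite det_jtmx0 // /ssyt_sum; have [/forallP E|] := boolP [forall i : 'I_l,
    nu i == mu i].
    have D0 (b : D) : False.
      have := shape_col shapeD b.
      by rewrite (eqP (E (Ordinal (shape_row shapeD b)))) /=; lia.
    rewrite (big_pred1 [ffun b => False_rect _ (D0 b)]) => [|T].
      by rewrite big1 // => b; case: (D0 b).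
    transitivity true.
      by apply/andP; split; [apply/ssytP; split=> b|apply/forallP => b];
        case: (D0 b).
    by symmetry; apply/eqP/ffunP => b; case: (D0 b).
  rewrite negb_forall => /existsP[i ne].
  have [b _] : exists b, row b = i /\ col b = mu i.
    by apply: (shape_ex shapeD); rewrite // leqnn ltn_neqAle eq_sym ne munu.
  by rewrite big_pred0 // => T; apply/negbTE/nandP; right; apply/forallP =>
    /(_ b).
rewrite (@det_jtmx_step _ _ _ (nu 0%N)) //.
(* Each tableau is weighted by the sum over its cuts, which has exactly one term, so that the two
   summations can be exchanged. *)
transitivity (\sum_(T : {ffun D -> 'I_V} | ssyt row col (fun b =>
  T b) && [forall b, (T b < N.+1)%N])
    \sum_(ka | @interlacing (nu 0) nu ka && cut_at row col N (fun b =>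
      T b) ka) \prod_b y (T b)).
  apply: eq_bigr => T /andP[ssT /forallP TN].
  have [ka0 ka0P] := cut_at_unique nuS nul (leqnn _) munu shapeD ssT TN.
  by rewrite (big_pred1 ka0).
rewrite (exchange_big_dep (interlacing nu)) /=; last by move=> T ka _ /andP[].
rewrite [RHS](bigID (fun ka : {ffun 'I_l -> 'I_(nu 0%N).+1} =>
  [forall i : 'I_l, mu i <= ka i]%N)) /=.
rewrite [X in _ = _ + X]big1 ?addr0; last first.
  move=> ka /andP[kaP]; rewrite negb_forall => /existsP[i]; rewrite -ltnNge =>
    lti.
  rewrite jtmx_ext_ord (@det_jtmx_eq0 _ _ _ _ _ _ i) ?mulr0 ?ext_ord_val //.
    exact: ext_ord_antitone kaP.
  by rewrite ext_ord_out.
apply: eq_bigr => ka kaP.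
transitivity (\prod_(i < l) y N ^+ (nu i - ka i) *
    ssyt_sum (fun b : {b | subshape row col ka b} => row (val b)) (fun b =>
      col (val b)) N).
  rewrite -(ssyt_sum_cut_at nuS nul (leqnn _) shapeD kaP leN).
  by apply: eq_bigl => T; rewrite kaP -andbA.
congr (_ * _).
rewrite jtmx_ext_ord (IHN _ _ _ (ext_ord ka)) //.
- by case/andP: kaP => /ext_ord_antitone.
- by rewrite ext_ord_out.
- move=> i lti; rewrite -[i]/(val (Ordinal lti)) ext_ord_val.
  by case/andP: kaP => _ /forallP/(_ (Ordinal lti)).
- exact: is_shape_sub kaP.
exact: ltnW.
Qed.

End Branching.

(** * Coefficients in products of complete homogeneous polynomials *)

Section Duality.

Variable R : comNzRingType.

Definition varX (r k : nat) : {mpoly R[r]} := oapp (fun i : 'I_r =>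
  'X_i) 0 (insub k).

Lemma varXE r (i : 'I_r) : varX r i = 'X_i.
Proof. by rewrite /varX valK. Qed.

Lemma mcoeffXM r (k m : 'X_{1..r}) (p : {mpoly R[r]}) :
  ('X_[k] * p)@_m = if (k <= m)%MM then p@_(m - k) else 0.
Proof.
rewrite mulrC; case: ifPn => [le|nle].
  by rewrite -{1}(submK le) addmC mcoeffMX.
apply: memN_msupp_eq0; rewrite (perm_mem (msuppMX p k)); apply/mapP =>
  -[m' _ E].
by rewrite E lem_addr in nle.
Qed.

(** All monomials of degree b - a in the first N variables occur with coefficient 1. In the
    recursion only the term whose exponent b - c equals that of the last variable in m can
    contribute. Writing the degree condition as a sum covers b < a as well. *)
Lemma mcoeff_hdiff_le r N b a m : (N <= r)%N ->
  (hdiff (varX r) N b a)@_m =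
    ((mdeg m + a == b)%N && [forall i : 'I_r, (N <= i)%N ==> (m i == 0%N)])%:R.
Proof.
elim: N b m => [|N IHN] b m leN.
  rewrite /hdiff raddfMn /= mcoeff1 -mulrnA mulnb.
  congr (nat_of_bool _)%:R; rewrite andbC.
  have -> : (m == 0%MM) = [forall i : 'I_r, (0 <= i)%N ==> (m i == 0%N)].
    apply/eqP/forallP => [-> i|m0]; first by rewrite mnm0E eqxx implybT.
    by apply/mnmP => i; rewrite mnm0E; apply/eqP/(implyP (m0 i)).
  case: forallP => [m0|]; rewrite ?andbF // !andbT eq_sym.
  by rewrite mdegE big1 // => i _; apply/eqP/(implyP (m0 i)).
pose iN : 'I_r := Ordinal leN.
have termE c : (varX r N ^+ (b - c) * hdiff (varX r) N c a)@_m =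
    ((b - c == m iN)%N && ((mdeg m + a == c + m iN)%N
      && [forall i : 'I_r, (N < i)%N ==> (m i == 0%N)]))%:R.
  set k := (b - c)%N; rewrite -[N in varX r N]/(val iN) varXE mpolyXn mcoeffXM.
  have -> : ((U_(iN) *+ k)%MM <= m)%MM = (k <= m iN)%N.
    apply/mnm_lepP/idP => [/(_ iN)|le i]; rewrite mulmnE mnm1E ?eqxx ?mul1n //.
    by case: eqP => [<-|]; rewrite ?mul1n ?mul0n.
  case: (leqP k (m iN)) => [le|gt]; last by rewrite (gtn_eqF gt).
  have leU : (U_(iN) *+ k <= m)%MM.
    apply/mnm_lepP => i; rewrite mulmnE mnm1E.
    by case: eqP => [<-|]; rewrite ?mul1n ?mul0n.
  rewrite IHN ?(ltnW leN) //; congr (nat_of_bool _)%:R.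
  have -> : mdeg m = (mdeg (m - U_(iN) *+ k)%MM + k)%N.
    by rewrite -{1}(submK leU) mdegD mdegMn mdeg1 mul1n.
  apply/andP/and3P => [[/eqP E /forallP m0]|[/eqP E1 /eqP E2 /forallP m0]].
    have := m0 iN; rewrite leqnn mnmBE mulmnE mnm1E eqxx mul1n /= => /eqP E'.
    split; [by apply/eqP; lia | by apply/eqP; lia |].
    apply/forallP => i; have := m0 i; rewrite mnmBE mulmnE mnm1E.
    case: (eqVneq iN i) => [<-|_]; first by rewrite /= ltnn.
    by rewrite mul0n subn0 leq_eqVlt; case: (N < i)%N; rewrite ?orbT.
  split; first by apply/eqP; lia.
  apply/forallP => i; rewrite mnmBE mulmnE mnm1E.
  case: (eqVneq iN i) => [<-|ne]; first by rewrite mul1n E1 subnn eqxx implybT.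
  have := m0 i; rewrite mul0n subn0 [(N <= i)%N]leq_eqVlt.
  by rewrite (_ : (N == i) = false) //; apply: contraNF ne => /eqP E;
    apply/eqP/val_inj.
rewrite {1}/hdiff -/hdiff raddf_sum /=.
under eq_bigr => c _ do rewrite termE.
have [le|gt] := leqP (m iN) b; last first.
  rewrite big_nat_cond big1 => [|c lec]; last first.
    by rewrite (_ : (b - c == m iN)%N = false) //; lia.
  rewrite (_ : (_ == b) = false) //; apply/negbTE/eqP => E; move: gt.
  by rewrite -E mdegE (bigD1 iN) //=; lia.
rewrite (bigD1_seq (b - m iN)%N) ?iota_uniq ?mem_index_iota //=; last by lia.
rewrite big_nat_cond big1 ?addr0 => [|c lec]; last first.
  by rewrite (_ : (b - c == m iN)%N = false) //; lia.
by rewrite subnK // subKn // eqxx.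
Qed.

Lemma mcoeff_hdiff r b a m :
  (hdiff (varX r) r b a)@_m = (mdeg m + a == b)%N%:R.
Proof.
rewrite mcoeff_hdiff_le // (_ : [forall _, _]) ?andbT //.
by apply/forallP => i; rewrite leqNgt ltn_ord.
Qed.

Lemma hdiffE r B b a : (b < B)%N ->
  hdiff (varX r) r b a =
    \sum_(c : {ffun 'I_r -> 'I_B} | (\sum_j c j + a == b)%N)
      'X_[[multinom (c j : nat) | j < r]].
Proof.
move=> ltb; apply/mpolyP => m; rewrite mcoeff_hdiff raddf_sum /=.
under eq_bigr => c _ do rewrite mcoeffX.
have [E|ne] := eqVneq (mdeg m + a)%N b; last first.
  rewrite big1 // => c /eqP cE; case: eqP => // E; case/eqP: ne.
  rewrite -cE -E mdegE; congr (_ + _)%N; apply: eq_bigr => j _.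
  by rewrite mnmE.
have ltm j : (m j < B)%N.
  by apply: leq_ltn_trans ltb; rewrite -E mdegE (bigD1 j) //= -addnA leq_addr.
rewrite (bigD1 [ffun j => Ordinal (ltm j)]) /=; last first.
  rewrite -E mdegE; apply/eqP; congr (_ + _)%N.
  by apply: eq_bigr => j _; rewrite ffunE.
rewrite big1 ?addr0 => [|c /andP[_ ne]].
  by rewrite (_ : _ == m) //; apply/eqP/mnmP => j; rewrite mnmE ffunE.
case: eqP => // cE; case/eqP: ne; apply/ffunP => j; rewrite ffunE.
by apply: val_inj; rewrite /= -cE mnmE.
Qed.

(** Row i of M is the exponent of the monomial chosen in factor i, so column sums are the exponents
    of the product. The bound B only makes the set of matrices finite. *)
Lemma mcoeff_prod_hdiff l r B (A a : 'I_l -> nat) (C c : 'I_r -> nat) :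
    (forall i, (A i < B)%N) ->
  ('X_[[multinom c j | j < r]] * \prod_i hdiff (varX r) r (A i) (a i))
    @_[multinom C j | j < r] =
  \sum_(M : {ffun 'I_l -> {ffun 'I_r -> 'I_B}})
    ([forall i, (\sum_j M i j + a i == A i)%N] &&
     [forall j, (\sum_i M i j + c j == C j)%N])%:R.
Proof.
move=> ltA.
under eq_bigr => i _ do rewrite (hdiffE _ _ (ltA i)) big_mkcond.
rewrite bigA_distr_bigA mulr_sumr raddf_sum /=; apply: eq_bigr => M _.
have [/forallP rowM|] := boolP [forall i, (\sum_j M i j + a i == A i)%N];
  last first.
  rewrite negb_forall => /existsP[i ni].
  by rewrite (bigD1 i) //= (negPf ni) mul0r mulr0 mcoeff0.
under eq_bigr => i _ do rewrite rowM -[X in 'X_[X]]mulm1n -mpolyXn.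
rewrite mprodXnE -mpolyXD mcoeffX; congr (nat_of_bool _)%:R.
apply/eqP/forallP => [/mnmP E j|E].
  have := E j; rewrite !mnmE mnm_sumE => <-; apply/eqP; rewrite addnC.
  by congr (_ + _)%N; apply: eq_bigr => i _; rewrite mulmnE mnmE muln1.
apply/mnmP => j; rewrite !mnmE mnm_sumE -(eqP (E j)) addnC.
by congr (_ + _)%N; apply: eq_bigr => i _; rewrite mulmnE mnmE muln1.
Qed.

(* Both sides count the nonnegative integer matrices with row sums A - a and
   column sums C - c. *)
Lemma hdiff_duality l r (A a : 'I_l -> nat) (C c : 'I_r -> nat) :
  ('X_[[multinom c j | j < r]] * \prod_i hdiff (varX r) r (A i) (a i))
    @_[multinom C j | j < r] =
  ('X_[[multinom a i | i < l]] * \prod_j hdiff (varX l) l (C j) (c j))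
    @_[multinom A i | i < l].
Proof.
pose B := (\sum_i A i + \sum_j C j).+1.
rewrite (@mcoeff_prod_hdiff _ _ B) => [|i]; last first.
  by rewrite ltnS (bigD1 i) //= -addnA leq_addr.
rewrite (@mcoeff_prod_hdiff _ _ B) => [|j]; last first.
  by rewrite ltnS addnC (bigD1 j) //= -addnA leq_addr.
pose tr p q (M : {ffun 'I_p -> {ffun 'I_q -> 'I_B}}) := [ffun j => [ffun i =>
  M i j]].
have trK p q : cancel (@tr p q) (@tr q p).
  by move=> M; apply/ffunP => i; apply/ffunP => j; rewrite !ffunE.
rewrite (reindex_onto (@tr r l) (@tr l r)) => [|M _]; last exact: trK.
apply: eq_big => [M|M _]; first by rewrite trK eqxx.
rewrite andbC; congr (nat_of_bool (_ && _))%:R.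
  apply: eq_forallb => j; congr (_ + _ == _)%N.
  by apply: eq_bigr => i _; rewrite !ffunE.
apply: eq_forallb => j; congr (_ + _ == _)%N.
by apply: eq_bigr => i _; rewrite !ffunE.
Qed.

End Duality.

(** * Tableaux on [cell]: determinants and coefficients *)

Lemma cell_shape (nu mu : seq nat) l :
    (forall i, (l <= i)%N -> nth 0%N nu i = 0%N) ->
  is_shape (@crow nu mu) (@ccol nu mu) l (nth 0%N nu) (nth 0%N mu).
Proof.
move=> nu0; split=> [b c [/val_inj E1 /val_inj E2]|i j].
  by apply: val_inj; move: E1 E2; case: (val b) (val c) => ? ? [? ?] /= -> ->.
split=> [[b [<- <-]]|[lti ltj]].
  split; last exact: (valP b).
  rewrite ltnNge; apply/negP => /nu0 E; have := valP b.
  by rewrite -/(crow b) E ltn0 andbF.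
have ltis : (i < size nu)%N.
  by rewrite ltnNge; apply/negP => /(nth_default 0%N) E; move: ltj; rewrite E;
    lia.
have ltjm : (j < \max_(k <- nu) k)%N.
  by case/andP: ltj => _ /leq_trans; apply; apply: leq_bigmax_seq;
    rewrite ?mem_nth.
by exists (exist _ (Ordinal ltis, Ordinal ltjm) ltj : cell nu mu).
Qed.

Lemma is_SSYTE (nu mu : seq nat) N (T : {ffun cell nu mu -> 'I_N}) :
  is_SSYT T = ssyt (@crow nu mu) (@ccol nu mu) (fun b => T b).
Proof. by []. Qed.

Lemma SSYT_sum_det (R : comNzRingType) l (nu mu : seq nat) r :
    (forall i, nth 0 nu i.+1 <= nth 0 nu i)%N ->
    (forall i, nth 0 mu i.+1 <= nth 0 mu i)%N ->
    (forall i, (l <= i)%N -> nth 0%N nu i = 0%N) ->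
    (forall i, (i < l)%N -> (nth 0 mu i <= nth 0 nu i)%N) ->
  \sum_(T : {ffun cell nu mu -> 'I_r} | is_SSYT T) \prod_b 'X_(T b)
    = \det (jtmx (varX R r) l r (nth 0%N nu) (nth 0%N mu)) :> {mpoly R[r]}.
Proof.
move=> nuS muS nu0 munu.
rewrite -(@jacobi_trudi _ _ _ r _ muS _ _ _ _ _ nuS _ munu (cell_shape mu nu0))
  ?nu0 //.
rewrite /ssyt_sum; apply: eq_big => T; last first.
  by move=> _; apply: eq_bigr => b _; rewrite varXE.
by rewrite is_SSYTE (_ : [forall b, _]) ?andbT //; apply/forallP => b.
Qed.

Lemma mcoeff_SSYT_sum (R : comNzRingType) (nu mu : seq nat) r m :
  (\sum_(T : {ffun cell nu mu -> 'I_r} | is_SSYT T)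
     \prod_b 'X_(T b) : {mpoly R[r]})@_m =
  #|[set T : {ffun cell nu mu -> 'I_r} |
     is_SSYT T && [forall k, #|[pred b | T b == k]| == m k]]|%:R.
Proof.
rewrite raddf_sum /= cardsE -sum1_card natr_sum big_mkcond [RHS]big_mkcond /=.
apply: eq_bigr => T _; rewrite unfold_in; case: is_SSYT => //=.
under eq_bigr => b _ do rewrite -[U_(_)%MM]mulm1n -mpolyXn.
rewrite mprodXnE mcoeffX.
rewrite (_ : (_ == m) = [forall k, #|[pred b | T b == k]| == m k]);
  first by case: ifP.
have E k : (\sum_b U_(T b) *+ 1)%MM k = #|[pred b | T b == k]|.
  rewrite mnm_sumE -sum1_card [RHS]big_mkcond; apply: eq_bigr => b _.
  by rewrite mulmnE mnm1E muln1 inE; case: eqP.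
by apply/eqP/forallP => [<- k|mP]; [rewrite E | apply/mnmP => k; rewrite E;
  apply/eqP].
Qed.

(** * Partial sums, the dominance order and tableaux of straight shape *)

Definition psum l (f : 'I_l -> nat) (j : nat) : nat :=
  (\sum_(i < l | (i < j)%N) f i)%N.

Lemma psumS l (f : 'I_l -> nat) (i : 'I_l) : psum f i.+1 = (psum f i + f i)%N.
Proof.
rewrite /psum (bigD1 i) /= ?ltnSn // addnC; congr (_ + _)%N.
by apply: eq_bigl => k; rewrite -val_eqE /=; lia.
Qed.

Lemma psum_inj l (f g : 'I_l -> nat) : psum f =1 psum g -> f =1 g.
Proof. by move=> E i; apply: (@addnI (psum f i)); rewrite -psumS E psumS E. Qed.

Lemma psumD l (f g : 'I_l -> nat) j :
  psum (fun i => f i + g i)%N j = (psum f j + psum g j)%N.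
Proof. exact: big_split. Qed.

(** The first j staircase entries are the largest ones. With threshold c = l - j and g the excess
    over c of the first j entries, c + g bounds the staircase everywhere and agrees with it on the
    first j places, while the sum of g over all places is invariant under s. *)
Lemma psum_staircase_perm l (s : 'S_l) j :
  (psum (fun i => staircase l (s i)) j <= psum (fun i : 'I_l =>
    staircase l i) j)%N.
Proof.
pose c := (l - j)%N; pose g (i : nat) := if (i < j)%N then (staircase l i -
  c)%N else 0%N.
have le i : (staircase l i <= c + g i)%N.
  by rewrite /g /c /staircase; case: ifP; lia.
have eq (i : 'I_l) : (i < j)%N -> staircase l i = (c + g i)%N.
  by move=> lti; rewrite /g lti /c /staircase; have := ltn_ord i; lia.
rewrite /psum [leqRHS](eq_bigr _ (eq)).
apply: (@leq_trans (\sum_(i < l | (i < j)%N) (c + g (s i)))%N).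
  by apply: leq_sum => i _.
rewrite !big_split leq_add2l.
apply: (@leq_trans (\sum_(i < l) g (s i))%N).
  by rewrite big_mkcond; apply: leq_sum => i _; case: ifP.
rewrite -(reindex_inj (h := s) (@perm_inj _ s) (P := xpredT) (F := fun i =>
  g i)) /=.
rewrite [leqRHS]big_mkcond; apply: leq_sum => i _.
by rewrite /g; case: ifP.
Qed.

Section StraightShape.

Variables (la : seq nat) (l : nat).
Hypothesis laS : forall i, (nth 0 la i.+1 <= nth 0 la i)%N.
Hypothesis la0 : forall i, (l <= i)%N -> nth 0%N la i = 0%N.

Let lan (i : 'I_l) : nat := nth 0%N la i.
Let shape := cell_shape [::] la0.

Lemma SSYT_crow_le r (T : {ffun cell la [::] -> 'I_r}) b :
  is_SSYT T -> (crow b <= T b)%N.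
Proof.
move=> /ssytP[_ Tc]; move: {2}(crow b) (erefl (crow b)) => k.
elim: k b => [|k IHk] b kb; first by rewrite kb.
have [c [rc cc]] : exists c : cell la [::], crow c = k /\ ccol c = ccol b.
  have := shape_row shape b; have := shape_col shape b; rewrite kb => h1 h2.
  apply: (shape_ex shape); first by lia.
  by have := laS k; move: h1; rewrite !nth_nil; lia.
have := Tc c b cc; rewrite rc kb ltnSn => /(_ isT).
by have := IHk c rc; rewrite rc; lia.
Qed.

Lemma psum_crow j :
  (\sum_(b : cell la [::]) (crow b < j)%N)%N = psum lan j.
Proof.
rewrite (big_shape _ (fun i _ => nat_of_bool (i < j)%N) shape) /=.
rewrite /psum [RHS]big_mkcond; apply: eq_bigr => i _.
by rewrite sum_nat_const_nat nth_nil subn0; case: ifP; rewrite ?muln1 ?muln0.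
Qed.

Definition content r (T : {ffun cell la [::] -> 'I_r}) (k : 'I_r) : nat :=
  #|[pred b | T b == k]|.

Lemma psum_content r (T : {ffun cell la [::] -> 'I_r}) j :
  psum (content T) j = (\sum_b (T b < j)%N)%N.
Proof.
transitivity (\sum_(k < r | (k < j)%N) \sum_(b | T b == k) 1)%N.
  by apply: eq_bigr => k _; rewrite /content -sum1_card.
rewrite -big_mkcond /=.
rewrite (partition_big (fun b => T b) (fun k : 'I_r => (k < j)%N)) //=.
apply: eq_bigr => k ltk; apply: eq_bigl => b.
by case: eqP => [->|]; rewrite ?andbF // ltk.
Qed.

(** An entry below j can only lie in a row below j, because columns increase strictly from at least
    0. *)
Lemma psum_content_le r (T : {ffun cell la [::] -> 'I_r}) j :
  is_SSYT T -> (psum (content T) j <= psum lan j)%N.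
Proof.
move=> TP; rewrite psum_content -psum_crow; apply: leq_sum => b _.
by have := SSYT_crow_le b TP; lia.
Qed.

(** The diagonal Kostka number: the only such tableau has the entry k throughout row k. *)
Lemma SSYT_content_shape :
  #|[set T : {ffun cell la [::] -> 'I_l} |
     is_SSYT T && [forall k, content T k == lan k]]| = 1%N.
Proof.
pose T0 : {ffun cell la [::] -> 'I_l} := [ffun b =>
  Ordinal (shape_row shape b)].
rewrite (_ : [set _ | _] = [set T0]) ?cards1 //; apply/setP => T; rewrite !inE.
apply/andP/eqP => [[TP /forallP cT]|->].
  apply/ffunP => b; rewrite ffunE; apply: val_inj => /=.
  apply/eqP; rewrite eqn_leq SSYT_crow_le // andbT -ltnS.
  (* No box has an entry smaller than its row, so no difference is truncated; the two counts agree,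
     hence every term vanishes, and the one at b bounds [T b] by its row. *)
  have : (\sum_(c : cell la [::]) ((crow c < (crow b).+1) - (T c < (crow
    b).+1)))%N = 0%N.
    rewrite sumnB; last first.
      by move=> c _; case: ltnP => // /(leq_ltn_trans (SSYT_crow_le c TP)) ->.
    rewrite psum_crow -psum_content /psum.
    by apply/eqP; rewrite subn_eq0; apply: leq_sum => i _; rewrite (eqP (cT i)).
  move/eqP; rewrite sum_nat_eq0 => /forallP/(_ b); rewrite ltnSn /=.
  by case: ltnP.
split.
  apply/ssytP; split=> b c; rewrite !ffunE /=; last by [].
  by move=> ->.
apply/forallP => k; apply/eqP; apply: psum_inj k => j.
rewrite psum_content -psum_crow; apply: eq_bigr => b _.
by rewrite ffunE.
Qed.

End StraightShape.

(** * Schur polynomials paired with the Vandermonde alternant *)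

Section Orthogonality.

Variable R : comNzRingType.

Definition schur_poly (la : seq nat) (r : nat) : {mpoly R[r]} :=
  \sum_(T : {ffun cell la [::] -> 'I_r} | is_SSYT T) \prod_b 'X_(T b).

Definition stair l (s : 'S_l) : 'X_{1..l} := [multinom staircase l (s i) | i <
  l].

Definition vandermonde l : {mpoly R[l]} := \sum_(s : 'S_l) (-1) ^+ s *:
  'X_[stair s].

Definition shifted l (la : seq nat) : 'X_{1..l} :=
  [multinom (nth 0 la i + staircase l i)%N | i < l].

Variable l : nat.

Definition partition_le (la : seq nat) : Prop :=
  (forall i, nth 0 la i.+1 <= nth 0 la i)%N /\
  (forall i, (l <= i)%N -> nth 0%N la i = 0%N).

Lemma schur_polyE la : partition_le la ->
  schur_poly la l = \det (jtmx (varX R l) l l (nth 0%N la) (fun _ => 0%N)).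
Proof.
move=> [laS la0]; rewrite /schur_poly (@SSYT_sum_det _ l) //.
  by congr (\det _); apply/matrixP => i j; rewrite !mxE nth_nil.
by move=> i; rewrite !nth_nil.
Qed.

(** A box in row r, counted from 0, would need an entry at least r. *)
Lemma schur_poly_eq0 la r : (forall i, nth 0 la i.+1 <= nth 0 la i)%N ->
  nth 0%N la r != 0%N -> schur_poly la r = 0.
Proof.
move=> laS la0; apply: big_pred0 => T; apply/negbTE/negP => TP.
have lts : (r < size la)%N.
  by rewrite ltnNge; apply: contra la0 => le; rewrite nth_default.
have las i : (size la <= i)%N -> nth 0%N la i = 0%N by move=> le;
  rewrite nth_default.
have [b [rb cb]] : exists b : cell la [::], crow b = r /\ ccol b = 0%N.
  by apply: (shape_ex (cell_shape [::] las)) => //; rewrite nth_nil lt0n.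
by have := leq_ltn_trans (SSYT_crow_le laS las b TP) (ltn_ord (T b));
  rewrite rb ltnn.
Qed.

Definition pairing (ka la : seq nat) : R :=
  (vandermonde l * schur_poly ka l)@_(shifted l la).

(* Symmetric although ka and la play different roles: exchange rows and columns
   in the matrices counted by the two Jacobi-Trudi determinants. *)
Lemma pairing_sym ka la : partition_le ka -> partition_le la ->
  pairing ka la = pairing la ka.
Proof.
have E ka' la' : partition_le ka' -> pairing ka' la' =
  \sum_(s : 'S_l) \sum_(t : 'S_l) (-1) ^+ s * ((-1) ^+ t *
    ('X_[stair s] * \prod_(i < l) hdiff (varX R l) l
       (nth 0%N ka' i + staircase l i) (staircase l (t i)))@_(shifted l la')).
  move=> kaP; rewrite /pairing schur_polyE // /vandermonde mulr_suml raddf_sum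
    /=.
  apply: eq_bigr => s _; rewrite /determinant -scalerAl mcoeffZ mulr_sumr
    raddf_sum.
  rewrite mulr_sumr; apply: eq_bigr => t _; congr (_ * _).
  rewrite mulrCA.
  rewrite (_ : (-1) ^+ t * _ = (-1) ^+ t *: ('X_[stair s] * \prod_i jtmx (varX
    R l) l l (nth 0%N ka') (fun=> 0%N) i (t i))).
    rewrite /= mcoeffZ; congr (_ * (_ * _)@__).
    by apply: eq_bigr => i _; rewrite mxE.
  by rewrite mulr_sign scaler_sign.
(* Duality swaps ka with la and at the same time s, from the alternant, with t, from the
   determinant; the signs are symmetric in s and t. *)
move=> kaP laP; rewrite !E // exchange_big; apply: eq_bigr => t _.
apply: eq_bigr => s _; rewrite mulrCA; congr (_ * (_ * _)).
by rewrite hdiff_duality.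
Qed.

Lemma pairing_terms ka la :
  pairing ka la = \sum_(s : 'S_l | (stair s <= shifted l la)%MM)
    (-1) ^+ s * (schur_poly ka l)@_(shifted l la - stair s).
Proof.
rewrite /pairing /vandermonde mulr_suml raddf_sum [RHS]big_mkcond.
apply: eq_bigr => s _ /=; rewrite -scalerAl mcoeffZ mcoeffXM.
by case: ifP; rewrite ?mulr0.
Qed.

(** A nonzero coefficient provides a tableau of shape ka and content la + d - s(d), and content is
    dominated by shape. *)
Lemma term_dominance ka la (s : 'S_l) : partition_le ka ->
    (stair s <= shifted l la)%MM ->
    (schur_poly ka l)@_(shifted l la - stair s) != 0 ->
  forall j, (psum (fun i : 'I_l => nth 0 la i + staircase l i)%N j <=
    psum (fun i : 'I_l => nth 0%N ka i) j + psum (fun i =>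
      staircase l (s i)) j)%N.
Proof.
move=> [kaS ka0] les; rewrite mcoeff_SSYT_sum => ne0 j.
have : [set T : {ffun cell ka [::] -> 'I_l} | is_SSYT T &&
    [forall k, #|[pred b | T b == k]| == (shifted l la - stair s)%MM k]] !=
      set0.
  by apply: contraNneq ne0 => ->; rewrite cards0.
case/set0Pn => T; rewrite inE => /andP[TP /forallP cT].
apply: leq_trans (leq_add (psum_content_le kaS ka0 j TP) (leqnn _)).
rewrite -psumD; apply: leq_sum => i _; rewrite /content (eqP (cT i)) !mnmE.
by have /mnm_lepP/(_ i) := les; rewrite !mnmE => /subnK ->.
Qed.

(** Some term s is nonzero, and the partial sums of s(d) are at most those of d, so d cancels from
    the inequality for that term. *)
Lemma pairing_dominance ka la : partition_le ka -> pairing ka la != 0 ->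
  forall j, (psum (fun i : 'I_l => nth 0%N la i) j <=
    psum (fun i : 'I_l => nth 0%N ka i) j)%N.
Proof.
move=> kaP ne0 j.
have [s /andP[les sP]|all0] := pickP (fun s : 'S_l =>
  (stair s <= shifted l la)%MM
    && ((schur_poly ka l)@_(shifted l la - stair s) != 0)).
  have := term_dominance kaP les sP j; have := psum_staircase_perm s j.
  by rewrite psumD; lia.
case/eqP: ne0; rewrite pairing_terms big1 // => s les.
by have := all0 s; rewrite les => /negbFE/eqP ->; rewrite mulr0.
Qed.

(** For ka = la, a nonzero term forces the partial sums of s(d) and d to coincide, so s is the
    identity; its term is the diagonal Kostka number. *)
Lemma pairing1 la : partition_le la -> pairing la la = 1.
Proof.
move=> laP; have [laS la0] := laP; rewrite pairing_terms.
have le1 : (stair (1%g : 'S_l) <= shifted l la)%MM.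
  by apply/mnm_lepP => i; rewrite !mnmE perm1 leq_addl.
rewrite (bigD1 1%g) //= odd_perm1 expr0 mul1r.
rewrite [X in _ + X]big1 ?addr0 => [|s /andP[les ne1]]; last first.
  case: (eqVneq (schur_poly la l)@_(shifted l la - stair s) 0) => [->|ne0].
    by rewrite mulr0.
  case/eqP: ne1; apply/permP => i; rewrite perm1; apply: val_inj.
  have E : psum (fun i => staircase l (s i)) =1 psum (fun i : 'I_l =>
    staircase l i).
    move=> j; have := term_dominance laP les ne0 j.
    by have := psum_staircase_perm s j; rewrite psumD; lia.
  have /= := psum_inj E i; have := ltn_ord i; have := ltn_ord (s i);
    rewrite /staircase; lia.
rewrite mcoeff_SSYT_sum -[RHS]/(1%:R) -(SSYT_content_shape laS la0).
congr (_%:R); apply: eq_card => T; rewrite !inE; congr (_ && _).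
by apply: eq_forallb => k; rewrite /content !mnmE perm1 addnK.
Qed.

Lemma pairing_eq0 ka la (i : 'I_l) : partition_le ka -> partition_le la ->
  nth 0%N ka i != nth 0%N la i -> pairing ka la = 0.
Proof.
move=> kaP laP; apply: contraNeq => ne0; apply/eqP.
have ne0' : pairing la ka != 0 by rewrite pairing_sym.
pose f (la : seq nat) (i : 'I_l) := nth 0%N la i.
suff : psum (f ka) =1 psum (f la) by move=> /psum_inj/(_ i).
move=> j; apply/eqP; rewrite eqn_leq.
by rewrite (pairing_dominance kaP ne0) (pairing_dominance laP ne0').
Qed.

End Orthogonality.

(** * Multinomial coefficients, the coefficients of W and Aitken's determinant *)

(** The multinomial theorem with denominators cleared, hence valid over any commutative ring.
    Splitting off one factor weights the term of variable i by m_i, and these weights add up to the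
    degree N + 1. *)
Lemma mcoeff_linear_form_exp (R : comNzRingType) r (z : 'I_r ->
  R) N (m : 'X_{1..r}) :
  (\prod_i (m i)`!)%:R * ((\sum_i z i *: 'X_i) ^+ N)@_m =
    (mdeg m == N)%:R * N`!%:R * \prod_i z i ^+ m i.
Proof.
elim: N m => [|N IHN] m.
  rewrite expr0 mcoeff1 fact0 mulr1 -mdeg_eq0.
  have [/eqP|_] := eqVneq (mdeg m) 0%N; last by rewrite mulr0 mul0r.
  rewrite mdeg_eq0 => /eqP ->; rewrite mulr1 !big1 ?mul1r // => i _.
    by rewrite mnm0E expr0.
  by rewrite mnm0E.
have step i : (\prod_j (m j)`!)%:R * (z i * ('X_i * (\sum_i z i *: 'X_i) ^+
  N)@_m)
    = (m i)%:R * ((mdeg m == N.+1)%:R * N`!%:R * \prod_j z j ^+ m j).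
  rewrite mcoeffXM lep1mP; have [->|mi0] := eqVneq (m i) 0%N.
    by rewrite mul0r /= !mulr0.
  rewrite /=; set m' := (m - U_(i))%MM.
  have mE : m = (m' + U_(i))%MM by rewrite submK // lep1mP.
  have m'i : m i = (m' i).+1 by rewrite mE mnmDE mnm1E eqxx addn1.
  have m'j j : j != i -> m j = m' j.
    by move=> ne; rewrite mE mnmDE mnm1E eq_sym (negPf ne) addn0.
  have -> : (\prod_j (m j)`! = m i * \prod_j (m' j)`!)%N.
    rewrite (bigD1 i) //= [in RHS](bigD1 i) //= mulnA m'i factS;
      congr (_ * _)%N.
    by apply: eq_bigr => j /m'j ->.
  have -> : \prod_j z j ^+ m j = z i * \prod_j z j ^+ m' j.
    rewrite (bigD1 i) //= [in RHS](bigD1 i) //= mulrA m'i exprS; congr (_ * _).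
    by apply: eq_bigr => j /m'j ->.
  have -> : (mdeg m == N.+1) = (mdeg m' == N) by rewrite mE mdegD mdeg1 addn1.
  rewrite natrM -mulrA [X in _ * X]mulrCA IHN.
  by rewrite [z i * (_ * _)]mulrCA.
rewrite exprS mulr_suml raddf_sum mulr_sumr /=.
under eq_bigr => i _ do rewrite -scalerAl mcoeffZ step.
rewrite -mulr_suml -natr_sum -mdegE factS natrM.
by have [->|] := eqVneq (mdeg m) N.+1; rewrite ?mul0r ?mulr0 // !mul1r mulrA.
Qed.

Section Factorials.

Variable C : numClosedFieldType.

Lemma fact_natr_neq0 k : k`!%:R != 0 :> C.
Proof. by rewrite pnatr_eq0 -lt0n fact_gt0. Qed.

Lemma prod_fact_neq0 r (m : 'I_r -> nat) : (\prod_i (m i)`!)%:R != 0 :> C.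
Proof. by rewrite natr_prod; apply/prodf_neq0 => i _;
  exact: fact_natr_neq0. Qed.

Definition multicoef r (N : nat) (m : 'X_{1..r}) : C :=
  (mdeg m == N)%:R * N`!%:R * (\prod_i (m i)`!)%:R^-1.

Lemma card_unity_roots e : (0 < e)%N -> #|{: seq_sub (unity_roots C e)}| = e.
Proof.
move=> e0; have [z zP] := exists_prim_root C e0.
have memz (i : 'I_e) : z ^+ i \in unity_roots C e.
  by rewrite Defs.mem_unity_roots // exprAC (prim_expr_order zP) expr1n.
pose f i : seq_sub (unity_roots C e) := SeqSub (memz i).
have fI : injective f.
  move=> i j /(congr1 val) /= /eqP; rewrite (eq_prim_root_expr zP).
  by rewrite !modn_small // => /eqP /val_inj.
rewrite -[RHS]card_ord -(card_codom fI); apply: eq_card => x; symmetry.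
have /(prim_rootP zP)[i xE] : val x ^+ e = 1.
  by apply/eqP; rewrite -Defs.mem_unity_roots // (valP x).
by apply/codomP; exists i; apply: val_inj.
Qed.

Lemma multicoefE r (z : 'I_r -> C) N m :
  ((\sum_i z i *: 'X_i) ^+ N)@_m = multicoef N m * \prod_i z i ^+ m i.
Proof.
apply: (mulfI (prod_fact_neq0 m)); rewrite mcoeff_linear_form_exp /multicoef.
by rewrite mulrA [X in _ = X * _]mulrC divfK // prod_fact_neq0.
Qed.

(** At exponents divisible by e every choice of roots of unity contributes the same amount, and the
    e^r choices cancel the normalising factor. *)
Lemma mcoeff_Wroot e n r (m : 'X_{1..r}) : (0 < e)%N ->
  (Wroot C e n r)@_(m *+ e) = multicoef (e * n) (m *+ e)%MM.
Proof.
move=> e0; rewrite /Wroot mcoeffZ raddf_sum /=.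
under eq_bigr => zeta _.
  rewrite multicoefE big1 ?mulr1 => [|i _]; last first.
    rewrite mulmnE mulnC exprM -[RHS](expr1n _ (m i)); congr (_ ^+ _).
    by apply/eqP; rewrite -Defs.mem_unity_roots // (valP (zeta i)).
  over.
rewrite sumr_const cardT /= -cardE card_ffun card_unity_roots // card_ord.
by rewrite -[X in _ * X]mulr_natl mulrA natrX mulVf ?mul1r // expf_neq0 //
  pnatr_eq0 -lt0n.
Qed.

(** The monomial expansion of W. All exponents in the support of [Wroot] are multiples of e, so
    dividing them by e merges no two monomials. *)
Lemma mcoeff_W e n r (m : 'X_{1..r}) : (0 < e)%N ->
  (W C e n r)@_m = multicoef (e * n) (m *+ e)%MM.
Proof.
move=> e0; rewrite -mcoeff_Wroot // /W raddf_sum /=.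
have E m' : m' \in msupp (Wroot C e n r) ->
    ([multinom (m' i %/ e)%N | i < r] == m) = (m' == m *+ e)%MM.
  move=> m'P; apply/eqP/eqP => [<-|->]; apply/mnmP => i.
    by rewrite mulmnE mnmE divnK // (Wroot_dvd e0 i m'P).
  by rewrite mnmE mulmnE mulnK.
under eq_big_seq => m' m'P do rewrite mcoeffZ mcoeffX E //.
have [inW|ninW] := boolP ((m *+ e)%MM \in msupp (Wroot C e n r)); last first.
  rewrite (memN_msupp_eq0 ninW) big_seq big1 // => m' m'P.
  by case: eqP ninW => [<-|]; rewrite ?m'P // mulr0.
rewrite (bigD1_seq _ inW) ?msupp_uniq //= eqxx mulr1 big1 ?addr0 // =>
  m' /negPf ->.
by rewrite mulr0.
Qed.

(** The inverse factorial of b - a with the convention 1/k! = 0 for negative k; truncated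
    subtraction alone would give 1. *)
Definition invfact (b a : nat) : C := if (a <= b)%N then (b - a)`!%:R^-1 else 0.

Lemma prod_invfact r (A a : 'I_r -> nat) :
  \prod_i invfact (A i) (a i) =
    if [forall i, a i <= A i]%N then (\prod_i (A i - a i)`!)%:R^-1 else 0.
Proof.
case: ifPn => [/forallP le|].
  by rewrite natr_prod -prodfV; apply: eq_bigr => i _; rewrite /invfact le.
rewrite negb_forall => /existsP[i ni].
by rewrite (bigD1 i) //= /invfact (negPf ni) mul0r.
Qed.

Lemma sum_staircase_perm l (s : 'S_l) :
  (\sum_(i < l) staircase l (s i) = \sum_(i < l) staircase l i)%N.
Proof. by rewrite [RHS](reindex_inj (@perm_inj _ s)). Qed.

Definition Wschur (e l : nat) (la : nat -> nat) : C :=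
  \det (\matrix_(i < l, j < l)
    invfact (e * (la i + staircase l i)) (e * staircase l j)).

(** The sum over the terms of the alternant is the Leibniz expansion of the determinant. A
    permutation s with s(d) not below la + d contributes 0 on both sides. *)
Lemma mcoeff_vandermonde_W e n l (la : seq nat) : (0 < e)%N ->
    (\sum_(i < l) nth 0 la i = n)%N ->
  (vandermonde C l * W C e n l)@_(shifted l la) =
    (e * n)`!%:R * Wschur e l (nth 0%N la).
Proof.
move=> e0 sumla; rewrite /vandermonde mulr_suml raddf_sum mulr_sumr.
apply: eq_bigr => s _; rewrite -scalerAl /= mcoeffZ mcoeffXM mulrCA;
  congr (_ * _).
under [in RHS]eq_bigr => i _ do rewrite mxE.
rewrite (prod_invfact (fun i : 'I_l => e * (nth 0 la i + staircase l i))%N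
  (fun i => e * staircase l (s i))%N).
have -> : (stair s <= shifted l la)%MM =
    [forall i : 'I_l, e * staircase l (s i) <= e * (nth 0 la i + staircase l
      i)]%N.
  by apply/mnm_lepP/forallP => le i; have := le i; rewrite !mnmE leq_pmul2l.
case: ifPn => [/forallP le|]; last by rewrite mulr0.
rewrite mcoeff_W // /multicoef.
have les : (stair s <= shifted l la)%MM.
  by apply/mnm_lepP => i; have := le i; rewrite !mnmE leq_pmul2l.
have -> : mdeg ((shifted l la - stair s) *+ e)%MM = (e * n)%N.
  rewrite mdegMn mulnC; congr (_ * _)%N; apply: (@addIn (mdeg (stair s))).
  rewrite -mdegD submK // !mdegE -sumla (eq_bigr _ (fun i _ =>
    mnmE _ i)) big_split /=.
  congr (_ + _)%N; rewrite -(sum_staircase_perm s).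
  by apply: eq_bigr => i _; rewrite mnmE.
rewrite eqxx mul1r; congr (_ * (_%:R)^-1); apply: eq_bigr => i _.
by rewrite mulmnE !mnmE -mulnBr mulnC.
Qed.

(** The added row is (0, ..., 0, 1), and in the remaining minor both arguments of each entry grow by
    e, which leaves the inverse factorials unchanged. *)
Lemma WschurS e l (la : nat -> nat) : (0 < e)%N -> la l = 0%N ->
  Wschur e l.+1 la = Wschur e l la.
Proof.
move=> e0 la0; rewrite /Wschur (expand_det_row _ ord_max) (bigD1 ord_max) //=.
rewrite [X in _ + X]big1 ?addr0 => [|j ne]; last first.
  rewrite mxE /invfact la0 /= (_ : staircase l.+1 l = 0%N) ?muln0; last first.
    by rewrite /staircase subnn.
  rewrite leqn0 muln_eq0 [e == _]gtn_eqF //= (_ : (_ == _) = false) ?mul0r //.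
  by move: ne; rewrite -val_eqE /staircase /=; have := ltn_ord j; lia.
rewrite mxE la0 /invfact leqnn subnn fact0 invr1 mul1r /cofactor.
rewrite -signr_odd addnn odd_double expr0 mul1r; congr (\det _).
apply/matrixP => i j; rewrite !mxE /=.
have bumpE (k : 'I_l) : bump l k = k by rewrite /bump leqNgt ltn_ord.
rewrite !bumpE /invfact.
have st (k : 'I_l) : staircase l.+1 k = (staircase l k).+1.
  by rewrite /staircase; have := ltn_ord k; lia.
by rewrite !st addnS !mulnS leq_add2l subnDl.
Qed.

Lemma Wschur_stable e l l' (la : nat -> nat) : (0 < e)%N -> (l <= l')%N ->
  (forall i, (l <= i)%N -> la i = 0%N) -> Wschur e l' la = Wschur e l la.
Proof.
move=> e0 /subnK <- la0; elim: (l' - l)%N => // k IHk.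
by rewrite addSn WschurS ?la0 // leq_addl.
Qed.

Lemma hdiff10 l : hdiff (varX C l) l 1 0 = \sum_(i < l) 'X_i.
Proof.
apply/mpolyP => m; rewrite mcoeff_hdiff addn0 raddf_sum /=.
under eq_bigr => i _ do rewrite mcoeffX.
case: mdeg1P => [[i /eqP ->]|nm]; last first.
  by rewrite big1 // => i _; case: eqP => // E; case: nm; exists i; rewrite E.
rewrite (bigD1 i) //= eqxx big1 ?addr0 // => j ne.
by rewrite eq_mnm1 (negPf ne).
Qed.

(** There are as many values as boxes, so injective fillings are exactly those that use every value
    once. *)
Lemma is_SYT_content (nu mu : seq nat) (T : {ffun cell nu mu ->
  'I_(#|{: cell nu mu}|)}) :
  is_SYT T = is_SSYT T && [forall k, #|[pred b | T b == k]| == 1%N].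
Proof.
have content1 : injectiveb T = [forall k, #|[pred b | T b == k]| == 1%N].
  apply/injectiveP/forallP => [TI k|cT b c E].
    have /codomP[b ->] : k \in codom T by apply: inj_card_onto;
      rewrite ?card_ord.
    by apply/eqP/(eq_card1 (x := b)) => c; rewrite !inE (inj_eq TI).
  have : (#|[pred x | T x == T b]| <= 1)%N by rewrite (eqP (cT _)).
  by move/card_le1_eqP; apply; rewrite inE ?E.
rewrite /is_SYT -content1; apply/and3P/andP.
  move=> [TI /forallP Tr /forallP Tc]; split=> //; apply/ssytP; split=>
    b c /eqP E lt.
    by have /forallP/(_ c) := Tr b; rewrite E lt => /ltnW.
  by have /forallP/(_ c) := Tc b; rewrite E lt.
move=> [/ssytP[Tr Tc] TI]; split=> //; apply/forallP => b; apply/forallP => c;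
  apply/implyP => /andP[/eqP E lt]; last exact: Tc.
rewrite ltn_neqAle Tr // andbT; apply: contraTneq lt =>
  /val_inj/(injectiveP _ TI) ->.
by rewrite ltnn.
Qed.

(** Duality rewrites each Leibniz term of the Jacobi-Trudi determinant as a coefficient of x^a (x_1
    + ... + x_l)^N, with N the number of boxes, to which the multinomial theorem applies. *)
Lemma SYT_det l (nu mu : seq nat) :
    (forall i, nth 0 nu i.+1 <= nth 0 nu i)%N ->
    (forall i, nth 0 mu i.+1 <= nth 0 mu i)%N ->
    (forall i, (l <= i)%N -> nth 0%N nu i = 0%N) ->
    (forall i, (i < l)%N -> (nth 0 mu i <= nth 0 nu i)%N) ->
  #|SYT nu mu|%:R = (\sum_(i < l) (nth 0 nu i - nth 0 mu i))`!%:R *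
    \det (\matrix_(i < l, j < l)
      invfact (nth 0 nu i + staircase l i) (nth 0 mu j + staircase l j)).
Proof.
move=> nuS muS nu0 munu.
have NE : #|{: cell nu mu}| = (\sum_(i < l) (nth 0 nu i - nth 0 mu i))%N.
  rewrite -sum1_card (big_shape _ (fun _ _ => 1%N) (cell_shape mu nu0)) /=.
  by apply: eq_bigr => i _; rewrite sum_nat_const_nat muln1.
transitivity ((\sum_(T : {ffun cell nu mu -> 'I_(#|{: cell nu mu}|)} | is_SSYT
  T)
     \prod_b 'X_(T b) : {mpoly C[_]})@_[multinom 1%N | k < #|{: cell nu mu}|]).
  rewrite mcoeff_SSYT_sum; congr _%:R; apply: eq_card => T; rewrite !inE.
  rewrite is_SYT_content; congr (_ && _); apply: eq_forallb => k.
  by rewrite mnmE.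
rewrite (SSYT_sum_det _ _ nuS muS nu0 munu) NE; set N := (\sum_(i < l) _)%N.
rewrite /determinant raddf_sum mulr_sumr; apply: eq_bigr => s _ /=.
pose A (i : 'I_l) := (nth 0 nu i + staircase l i)%N.
pose a (i : 'I_l) := (nth 0 mu (s i) + staircase l (s i))%N.
under eq_bigr => i _ do rewrite mxE.
under [in RHS]eq_bigr => i _ do rewrite mxE.
rewrite (prod_invfact A a) mulrCA.
(* The trivial monomial factor is inserted to match [hdiff_duality] with all c j = 0 and C j = 1. *)
rewrite (_ : (-1) ^+ s * _ = (-1) ^+ s *: ('X_[[multinom 0%N | j < N]] *
    \prod_(i < l) hdiff (varX C N) N (A i) (a i))); last first.
  rewrite (_ : [multinom _ | _ < N] = 0%MM) ?mpolyX0 ?mul1r; last first.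
    by apply/mnmP => j; rewrite !mnmE.
  by rewrite mulr_sign scaler_sign.
rewrite mcoeffZ; congr (_ * _); rewrite hdiff_duality mcoeffXM.
rewrite (eq_bigr _ (fun j _ => hdiff10 l)) prodr_const card_ord.
have -> : ([multinom a i | i < l] <= [multinom A i | i < l])%MM =
    [forall i, a i <= A i]%N.
  by apply/mnm_lepP/forallP => le i; have := le i; rewrite !mnmE.
case: ifPn => [/forallP le|]; last by rewrite mulr0.
rewrite (eq_bigr (fun i : 'I_l => 1 *: 'X_i)); last by move=> i _;
  rewrite scale1r.
rewrite multicoefE big1 ?mulr1 => [|i _]; last by rewrite expr1n.
rewrite /multicoef (_ : mdeg _ = N) ?eqxx ?mul1r.
  by congr (_ * (_%:R)^-1); apply: eq_bigr => i _; rewrite !mnmE.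
rewrite mdegE; apply: (@addIn (\sum_i a i)%N); rewrite -big_split /=.
transitivity (\sum_i A i)%N.
  by apply: eq_bigr => i _; rewrite !mnmE subnK.
have -> : (\sum_i a i = \sum_(i < l) (nth 0 mu i + staircase l i))%N.
  by rewrite [RHS](reindex_inj (@perm_inj _ s)).
rewrite /N -big_split; apply: eq_bigr => i _ /=.
by rewrite addnA subnK // munu.
Qed.

End Factorials.

(** * Partitions of n as padded sequences *)

Lemma sum_vanishing_tail (f : nat -> nat) a b :
    (forall i, (a <= i)%N -> f i = 0%N) -> (a <= b)%N ->
  (\sum_(i < b) f i = \sum_(i < a) f i)%N.
Proof.
move=> f0 leab; rewrite -!(big_mkord xpredT) (@big_cat_nat _ _ _ a) //=.
by rewrite [X in (_ + X)%N]big_nat_cond [X in (_ + X)%N]big1 ?addn0 // => i;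
  case: (leqP a i) => // /f0 ->.
Qed.

Section Intpart.

Variable n : nat.
Implicit Type la : intpart n.

Lemma size_parts la : size (parts la) = n.
Proof. by rewrite size_map size_tuple. Qed.

Lemma parts_antitone la i : (nth 0 (parts la) i.+1 <= nth 0 (parts la) i)%N.
Proof.
have [lt|le] := ltnP i.+1 n; last by rewrite nth_default // size_parts.
have /andP[sP _] := valP la.
by have /(sortedP 0%N)/(_ i) := sP; rewrite size_map size_tuple; apply.
Qed.

Lemma parts_vanish la l i : (part_length la <= l)%N -> (l <= i)%N ->
  nth 0%N (parts la) i = 0%N.
Proof.
move=> lel lei; apply/eqP/negPn/negP => ni.
have : (i < part_length la)%N; last by lia.
have lti : (i < size (parts la))%N.
  by rewrite ltnNge; apply: contra ni => le; rewrite nth_default.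
rewrite /part_length -(cat_take_drop i.+1 (parts la)) count_cat.
apply: (@leq_trans (count (fun k => k != 0%N) (take i.+1 (parts la))));
  last exact: leq_addr.
rewrite (_ : count _ _ = size (take i.+1 (parts la)));
  first by rewrite size_takel.
apply/eqP; rewrite -all_count; apply/(all_nthP 0%N) => j.
rewrite size_takel // => ltj; rewrite nth_take // -lt0n.
by apply: leq_trans (antitone_leq (parts_antitone la) (ltj : (j <= i)%N));
  rewrite lt0n.
Qed.

Lemma partition_le_length la l : (part_length la <= l)%N ->
  partition_le l (parts la).
Proof. by move=> lel; split; [exact: parts_antitone | move=> i;
  exact: parts_vanish]. Qed.

Lemma partition_le_or la l : partition_le l (parts la) \/ nth 0%N (parts la) l
  != 0%N.
Proof.
have [E|] := eqVneq (nth 0%N (parts la) l) 0%N; [left|by right].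
split=> [|i lei]; first exact: parts_antitone.
by have := antitone_leq (parts_antitone la) lei; rewrite E leqn0 => /eqP.
Qed.

Lemma partition_le_size la : partition_le n (parts la).
Proof.
split=> [|i lei]; first exact: parts_antitone.
by rewrite nth_default // size_parts.
Qed.

Lemma sum_parts la l : partition_le l (parts la) ->
  (\sum_(i < l) nth 0 (parts la) i)%N = n.
Proof.
move=> [_ la0]; have /andP[_ /eqP] := valP la.
rewrite sumnE -/(parts la) (big_nth 0%N) size_parts big_mkord => E.
rewrite -[RHS]E; have [_ la0'] := partition_le_size la.
by case: (leqP l n) => [le|/ltnW le]; [symmetry|]; apply: sum_vanishing_tail.
Qed.

Lemma parts_inj la la' l :
    partition_le l (parts la) -> partition_le l (parts la') ->
    (forall i : 'I_l, nth 0%N (parts la) i = nth 0%N (parts la') i) -> la = la'.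
Proof.
move=> [_ la0] [_ la0'] E; apply: val_inj; apply: val_inj.
apply: (inj_map val_inj); rewrite -!/(parts _).
apply: (@eq_from_nth _ 0%N) => [|i _]; first by rewrite !size_parts.
have [lt|le] := ltnP i l; first exact: (E (Ordinal lt)).
by rewrite la0 // la0'.
Qed.

(** Turns an exponent vector in any number r of variables into an [intpart n], which has room for n
    parts: a nonzero value at an index i >= n would give n + 1 positive values and a sum above n. *)
Lemma intpart_of_fun (f : nat -> nat) r :
    (forall i, f i.+1 <= f i)%N -> (forall i, (r <= i)%N -> f i = 0%N) ->
    (\sum_(i < r) f i)%N = n ->
  exists la, forall i, nth 0%N (parts la) i = f i.
Proof.
move=> fS f0 sumf.
have fn0 i : (n <= i)%N -> f i = 0%N.
  move=> lei; apply/eqP; rewrite -leqn0 leqNgt; apply/negP => fi.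
  have lt : (n < r)%N.
    by rewrite ltnNge; apply/negP => ler; rewrite f0 ?(leq_trans ler) // in fi.
  have : (\sum_(j < n.+1) 1 <= \sum_(j < n.+1) f j)%N.
    by apply: leq_sum => j _; apply: leq_trans fi (antitone_leq fS _); have :=
      ltn_ord j; lia.
  have : (\sum_(j < n.+1) f j <= n)%N.
    rewrite -[leqRHS]sumf -!(big_mkord xpredT f).
    by rewrite [leqRHS](@big_cat_nat _ _ _ n.+1) //= leq_addr.
  by move=> h2; rewrite sum1_card card_ord => /leq_trans/(_ h2); rewrite ltnn.
have sumfn : (\sum_(i < n) f i)%N = n.
  rewrite -[RHS]sumf; case: (leqP r n) => [le|/ltnW le]; [|symmetry];
    exact: sum_vanishing_tail.
have fle i : (f i <= n)%N.
  have [lt|/fn0 -> //] := ltnP i n.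
  by rewrite -[leqRHS]sumfn (bigD1 (Ordinal lt)) //= leq_addr.
pose t : n.-tuple 'I_n.+1 := [tuple inord (f i) | i < n].
have tE : [seq val i | i <- t] = mkseq f n.
  rewrite /= -map_comp /mkseq -val_enum_ord -map_comp; apply: eq_map => i /=.
  by rewrite inordK // ltnS.
have tP : is_intpart t.
  rewrite /is_intpart tE; apply/andP; split.
    apply/(sortedP 0%N) => i; rewrite size_mkseq => lt.
    by rewrite !nth_mkseq ?(ltnW lt) //; exact: fS.
  by rewrite sumnE big_map -[X in _ == X]sumfn -(big_mkord xpredT f)
    /index_iota subn0.
exists (exist _ t tP) => i; rewrite /parts /= tE.
have [lt|le] := ltnP i n; first by rewrite nth_mkseq.
by rewrite nth_default ?size_mkseq // fn0.
Qed.

End Intpart.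

(** * Existence of the Schur expansion and its coefficients *)

Section SchurExpansion.

Variable C : numClosedFieldType.

Lemma schurE la r : schur C la r = schur_poly C la r.
Proof. by []. Qed.

Lemma hdiff_sym r b a : hdiff (varX C r) r b a \is symmetric.
Proof.
apply/issymP => s; apply/mpolyP => m.
by rewrite mcoeff_sym !mcoeff_hdiff mdeg_mperm.
Qed.

(** Symmetry is read off the Jacobi-Trudi determinant, whose entries are complete homogeneous
    polynomials. *)
Lemma schur_poly_sym n (la : intpart n) r : schur_poly C (parts la) r \is
  symmetric.
Proof.
have [laP|la0] := partition_le_or la r; last first.
  by rewrite schur_poly_eq0 ?rpred0 //; exact: parts_antitone.
rewrite schur_polyE //; apply: rpred_sum => s _; rewrite mulr_sign.
have : \prod_i jtmx (varX C r) r r (nth 0%N (parts la)) (fun=>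
  0%N) i (s i) \is symmetric.
  by apply: rpred_prod => i _; rewrite mxE hdiff_sym.
by case: ifP; rewrite ?rpredN.
Qed.

Lemma W_sym e n r : (0 < e)%N -> W C e n r \is symmetric.
Proof.
move=> e0; apply/issymP => s; apply/mpolyP => m;
  rewrite mcoeff_sym !mcoeff_W //.
rewrite /multicoef !mdegMn mdeg_mperm; congr (_ * (_%:R)^-1).
rewrite [RHS](reindex_inj (@perm_inj _ s)); apply: eq_bigr => i _.
by rewrite !mulmnE mnmE.
Qed.

Lemma mcoeff_W_eq0 e n r m : (0 < e)%N -> mdeg m != n -> (W C e n r)@_m = 0.
Proof.
move=> e0 ne; rewrite mcoeff_W // /multicoef mdegMn mulnC eqn_pmul2l //.
by rewrite (negPf ne) !mul0r.
Qed.

Lemma mcoeff_schur_eq0 n (la : intpart n) r m :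
  mdeg m != n -> (schur_poly C (parts la) r)@_m = 0.
Proof.
move=> ne; rewrite mcoeff_SSYT_sum (_ : #|_| = 0%N) //; apply/eqP.
rewrite cards_eq0; apply/eqP/setP => T; rewrite !inE; apply/negbTE.
apply: contra ne => /andP[_ /forallP cT].
have [laS la0] := partition_le_size la.
apply/eqP; rewrite mdegE -[RHS](sum_parts (partition_le_size la)).
transitivity (psum (content T) r).
  by apply: eq_big => [k|k _]; rewrite ?ltn_ord // /content (eqP (cT k)).
rewrite psum_content; transitivity (psum (fun i : 'I_n =>
  nth 0%N (parts la) i) n).
  rewrite -(psum_crow la0); apply: eq_bigr => b _.
  by rewrite ltn_ord (shape_row (cell_shape [::] la0)).
by apply: eq_bigl => i; rewrite ltn_ord.
Qed.

(** The degrees agree. The first i moved by s satisfies s i > i, since all smaller indices are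
    fixed, and there the staircase exponent drops. *)
Lemma stair_lt l (s : 'S_l) : s != 1%g -> (stair s < stair (1%g : 'S_l))%O.
Proof.
move=> s1; apply/ltmcP.
  rewrite !mdegE (eq_bigr _ (fun i _ => mnmE _ i)) sum_staircase_perm.
  by apply: eq_bigr => i _; rewrite mnmE perm1.
have [i0 si0] : exists i, s i != i.
  apply/existsP; apply: contraNT s1; rewrite negb_exists => /forallP sP.
  by apply/eqP/permP => i; rewrite perm1; have := sP i; rewrite negbK => /eqP.
case: (@arg_minnP _ i0 (fun i => s i != i) (fun i => nat_of_ord i) si0) =>
  i si imin.
have fix_lt (j : 'I_l) : (j < i)%N -> s j = j.
  by move=> lt; apply/eqP; apply: contraTT lt => /imin; rewrite -leqNgt.
exists i => [j /fix_lt E|]; rewrite !mnmE perm1 ?E //.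
have lt : (i < s i)%N.
  rewrite ltn_neqAle eq_sym val_eqE si leqNgt; apply: contra si =>
    /fix_lt /perm_inj ->.
  by [].
by rewrite /staircase; have := ltn_ord (s i); lia.
Qed.

Lemma mcoeff_vandermonde r m :
  (vandermonde C r)@_m = \sum_(s : 'S_r) (-1) ^+ s * (stair s == m)%:R.
Proof.
by rewrite /vandermonde raddf_sum; apply: eq_bigr => s _;
  rewrite /= mcoeffZ mcoeffX.
Qed.

Lemma mcoeff_vandermonde1 r : (vandermonde C r)@_(stair (1%g : 'S_r)) = 1.
Proof.
rewrite mcoeff_vandermonde (bigD1 1%g) //= odd_perm1 eqxx mulr1.
by rewrite big1 ?addr0 // => s /stair_lt/lt_eqF ->; rewrite mulr0.
Qed.

Lemma mlead_vandermonde_le r : (mlead (vandermonde C r) <= stair (1%g :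
  'S_r))%O.
Proof.
have v0 : vandermonde C r != 0.
  apply/eqP => E; have := mcoeff_vandermonde1 r; rewrite E mcoeff0 => /eqP.
  by rewrite eq_sym oner_eq0.
move: (v0); rewrite -mleadc_eq0 leNgt; apply: contra => lt.
rewrite mcoeff_vandermonde big1 // => s _.
rewrite lt_eqF ?mulr0 // (le_lt_trans _ lt) //.
by have [->|/stair_lt/ltW] := eqVneq s 1%g.
Qed.

Lemma mcoeff_vandermonde_mlead r (p : {mpoly C[r]}) :
  (vandermonde C r * p)@_(stair (1%g : 'S_r) + mlead p) = mleadc p.
Proof.
by rewrite mleadcMW ?mcoeff_vandermonde1 ?mul1r ?mlead_vandermonde_le.
Qed.

(** The determinant is taken with n rows, enough for every partition of n and independent of r and
    l. *)
Definition schur_coef (e n : nat) (la : intpart n) : C :=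
  (e * n)`!%:R * Wschur C e n (nth 0%N (parts la)).

(** Orthogonality covers the ka with at most r parts; for the others the Schur polynomial in r
    variables is zero. *)
Lemma mcoeff_vandermonde_schur_sum e n r (a : intpart n -> C) (la : intpart n) :
    (0 < e)%N -> partition_le r (parts la) ->
  (vandermonde C r * \sum_ka a ka *: schur_poly C (parts ka) r)
    @_(shifted r (parts la)) = a la.
Proof.
move=> e0 laP; rewrite mulr_sumr raddf_sum (bigD1 la) //= big1 ?addr0 =>
  [|ka ne].
  by rewrite -scalerAr mcoeffZ -/(pairing _ _ _ _) pairing1 ?mulr1.
rewrite -scalerAr mcoeffZ; have [kaP|ka0] := partition_le_or ka r; last first.
  by rewrite schur_poly_eq0 ?mulr0 ?mcoeff0 ?mulr0 //; exact: parts_antitone.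
rewrite -/(pairing _ _ _ _).
case: (pickP (fun i : 'I_r => nth 0%N (parts ka) i != nth 0%N (parts la) i)) =>
  [i ni|eq].
  by rewrite (pairing_eq0 _ kaP laP ni) mulr0.
by case/eqP: ne; apply: (parts_inj kaP laP) => i; apply/eqP/negPn; rewrite eq.
Qed.

Lemma mcoeff_vandermonde_W_parts e n r (la : intpart n) :
    (0 < e)%N -> partition_le r (parts la) ->
  (vandermonde C r * W C e n r)@_(shifted r (parts la)) = schur_coef e la.
Proof.
move=> e0 laP; rewrite mcoeff_vandermonde_W ?sum_parts // /schur_coef;
  congr (_ * _).
have [_ la0] := laP; have [_ la0'] := partition_le_size la.
by case: (leqP r n) => [le|/ltnW le]; [symmetry|]; apply: Wschur_stable.
Qed.

(* If the difference G of both sides were nonzero, its leading monomial la would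
   be a partition by symmetry, and the coefficient of x^(la+d) in a_d G would be
   the leading coefficient of G; but that coefficient vanishes. *)
Lemma W_schur_expansion e n : (0 < e)%N -> is_schur_expansion (W C e n)
  (@schur_coef e n).
Proof.
move=> e0 r; apply/eqP; rewrite -subr_eq0; apply/negPn/negP.
set G := _ - _ => G0.
have symG : G \is symmetric.
  rewrite rpredB ?W_sym // rpred_sum // => ka _; rewrite rpredZ //.
  exact: schur_poly_sym.
(* Both sides are homogeneous of degree n, which makes the leading exponent a partition of n
   itself. *)
have degG : mdeg (mlead G) = n.
  apply/eqP; apply: contraNT G0 => ne; rewrite -mleadc_eq0 mcoeffB mcoeff_W_eq0
    //.
  rewrite raddf_sum big1 ?subr0 // => ka _.
  by rewrite /= mcoeffZ schurE mcoeff_schur_eq0 // mulr0.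
pose f i : nat := oapp (fun j : 'I_r => mlead G j) 0%N (insub i).
have fE (i : 'I_r) : f i = mlead G i by rewrite /f valK.
have f0 i : (r <= i)%N -> f i = 0%N by move=> lei; rewrite /f insubF //
  ltnNge lei.
have fS i : (f i.+1 <= f i)%N.
  have [le|lt] := leqP r i.+1; first by rewrite f0.
  rewrite -[i.+1]/(val (Ordinal lt)) -[i]/(val (Ordinal (ltnW lt))) !fE.
  by apply: mlead_msym_sorted.
have sumf : (\sum_(i < r) f i)%N = n.
  by rewrite -[RHS]degG mdegE; apply: eq_bigr => i _; rewrite fE.
have [la laE] := intpart_of_fun fS f0 sumf.
have laP : partition_le r (parts la).
  by split=> [|i lei]; [exact: parts_antitone | rewrite laE f0].
have : (vandermonde C r * G)@_(shifted r (parts la)) = 0.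
  rewrite mulrBr mcoeffB mcoeff_vandermonde_W_parts //.
  by rewrite (mcoeff_vandermonde_schur_sum _ e0 laP) subrr.
rewrite (_ : shifted r (parts la) = stair (1%g : 'S_r) + mlead G)%MM;
  last first.
  by apply/mnmP => i; rewrite !mnmE perm1 laE fE addnC.
by move/eqP; rewrite mcoeff_vandermonde_mlead mleadc_eq0 (negPf G0).
Qed.

Lemma schur_coef_SYT e n (la : intpart n) l : (0 < e)%N ->
  (part_length la <= l)%N ->
  schur_coef e la = #|SYT (xi_outer e l la) (xi_inner e l)|%:R.
Proof.
move=> e0 lel.
have laP := partition_le_length lel; have [laS la0] := laP.
have outE i : (i < l)%N -> nth 0%N (xi_outer e l la) i =
    (e * nth 0 (parts la) i + staircase l i * (e - 1))%N by move=> lt;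
      rewrite nth_mkseq.
have innE i : (i < l)%N -> nth 0%N (xi_inner e l) i = (staircase l i * (e -
  1))%N.
  by move=> lt; rewrite nth_mkseq.
have out0 i : (l <= i)%N -> nth 0%N (xi_outer e l la) i = 0%N.
  by move=> le; rewrite nth_default // size_mkseq.
have inn0 i : (l <= i)%N -> nth 0%N (xi_inner e l) i = 0%N.
  by move=> le; rewrite nth_default // size_mkseq.
rewrite (@SYT_det _ l) //.
- have -> : (\sum_(i < l) (nth 0 (xi_outer e l la) i - nth 0 (xi_inner e l) i)
  = e * n)%N.
    rewrite -[in RHS](sum_parts laP) big_distrr; apply: eq_bigr => i _ /=.
    by rewrite outE // innE // addnK.
  (* Passing through the polynomial coefficient in l variables replaces the n-row determinant by the
     l-row one. *)
  rewrite -(mcoeff_vandermonde_W_parts e0 laP).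
  rewrite mcoeff_vandermonde_W ?sum_parts //; congr (_ * \det _).
  apply/matrixP => i j; rewrite !mxE outE // innE //.
  have stE k : (staircase l k * (e - 1) + staircase l k = e * staircase l k)%N.
    by rewrite -{2}[staircase l k]muln1 -mulnDr subnK // mulnC.
  by rewrite -addnA !stE -mulnDr.
- move=> i; have [le|lt] := leqP l i.+1; first by rewrite out0.
  rewrite !outE ?(ltnW lt) // leq_add ?leq_mul // /staircase; lia.
- move=> i; have [le|lt] := leqP l i.+1; first by rewrite inn0.
  rewrite !innE ?(ltnW lt) // leq_mul // /staircase; lia.
by move=> i lt; rewrite outE // innE // leq_addl.
Qed.

End SchurExpansion.

Theorem theorem4p1 (C : numClosedFieldType) (e n : nat) (he : (0 < e)%N)
    (la : intpart n) (l : nat) (hl : (part_length la <= l)%N) :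
  (exists a : intpart n -> C, is_schur_expansion (W C e n) a) /\
  (forall a : intpart n -> C, is_schur_expansion (W C e n) a ->
     a la = (#|SYT (xi_outer e l la) (xi_inner e l)|)%:R).
Proof.
split=> [|a aP]; first by exists (@schur_coef C e n); exact: W_schur_expansion.
have laP := partition_le_length hl.
(* The assumed expansion is used in exactly l variables, where la fits. *)
rewrite -(schur_coef_SYT C he hl) -(mcoeff_vandermonde_W_parts C he laP) aP.
by rewrite (mcoeff_vandermonde_schur_sum a he laP).
Qed.
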